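(* Let $X\subset\mathbb{A}^N$ be a closed subscheme whose ideal is generated by $m$ polynomials, $I_X=(f_1,\ldots,f_m)\subset k[x_1,\ldots,x_N]$. Suppose that $m\le N$ and let $0\le e_1\le e_2\le\cdots\le e_m$ be an increasing sequence of integers. (a) For $l\ge e_m$ and $i\ge e_m$, we have $$\pi^{l+i}_l\bigl(\mathcal{L}^{e_1,\ldots,e_m}_{l+i}(X)\bigr)=\pi_l\bigl(\mathcal{L}^{e_1,\ldots,e_m}(X)\bigr),$$ and this set is locally closed (in $\mathcal{L}_l(\mathbb{A}^N)$). (b) For $\gamma\in\pi_{e_m}(\mathcal{L}^{e_1,\ldots,e_m}(X))$, there exists an open subset $U_{e_m}$ of $\pi_{e_m}(\mathcal{L}^{e_1,\ldots,e_m}(X))$ containing $\gamma$ such that, if for $i>e_m$ we denote by $U_i$ the inverse image of $U_{e_m}$ under the truncation map $\pi_i(\mathcal{L}^{e_1,\ldots,e_m}(X))\to\pi_{e_m}(\mathcal{L}^{e_1,\ldots,e_m}(X))$, then for every $l\ge e_m$ the truncation map $U_{l+1}\to U_l$ is a trivial fibration with fibre $\mathbb{A}^{N-m}$. (c) For $n>l\ge e_m$, the truncation map $$\pi_n(\mathcal{L}^{e_1,\ldots,e_m}(X))\to\pi_l(\mathcal{L}^{e_1,\ldots,e_m}(X))$$ is a locally trivial fibration with fibre $\mathbb{A}^{(N-m)(n-l)}$.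
   Context: $k$ is an algebraically closed field of arbitrary characteristic. For a closed subscheme $X\subset\mathbb{A}^N$ with ideal $I_X$, an $n$-jet on $X$ is a closed point of the jet scheme $\mathcal{L}_n(X)$, i.e. a tuple $\theta\in(k[t]/(t^{n+1}))^N$ with $f(\theta)=0$ for all $f\in I_X$; an arc on $X$ is a tuple $\gamma\in k[[t]]^N$ with $f(\gamma)=0$ for all $f\in I_X$. The sets of $n$-jets and of arcs are denoted $\mathcal{L}_n(X)$ and $\mathcal{L}(X)$. $\mathcal{L}_n(X)$ is a closed subset of $\mathcal{L}_n(\mathbb{A}^N)\cong\mathbb{A}^{N(n+1)}$ (Zariski topology). $\pi_n:\mathcal{L}(X)\to\mathcal{L}_n(X)$ and $\pi^n_l:\mathcal{L}_n(X)\to\mathcal{L}_l(X)$ ($n\ge l$) are the truncation maps. Locally closed subsets carry their reduced structure; a map is a trivial fibration with fibre $F$ if it is isomorphic to the projection of a product of the target with $F$, and a locally trivial fibration with fibre $F$ if this holds Zariski-locally on the target. For $\gamma\in\mathcal{L}(X)$, consider the quotient of the $k[[t]]$-module $k[[t]]^N$ by the submodule generated by the rows of the Jacobian matrix $\bigl(\frac{\partial f_i}{\partial x_j}(\gamma)\bigr)_{1\le i\le m,\,1\le j\le N}$. There is a unique sequence $0\le e_1\le\cdots\le e_p$ of integers, $0\le p\le\min\{m,N\}$, such that this quotient is isomorphic to $\bigoplus_{i=1}^p k[[t]]/(t^{e_i})\oplus k[[t]]^{N-p}$; write $p=p(X;\gamma)$, $e_i=e_i(X;\gamma)$ (they do not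 depend on the generators chosen for $I_X$). For integers $0\le e_1\le\cdots\le e_p$, $\mathcal{L}^{e_1,\ldots,e_p}(X)$ is the set of $\gamma\in\mathcal{L}(X)$ with $p(X;\gamma)=p$ and $e_i(X;\gamma)=e_i$ for $1\le i\le p$. For $\theta\in\mathcal{L}_n(X)$, consider the quotient of the $k[[t]]$-module $(k[[t]]/(t^{n+1}))^N$ by the submodule generated by the rows of $\bigl(\frac{\partial f_i}{\partial x_j}(\theta)\bigr)_{i,j}$. It is isomorphic to $\bigoplus_{i=1}^N k[[t]]/(t^{e_i})$ for a unique sequence $0\le e_1\le\cdots\le e_N\le n+1$; write $e_i=e_i(X;\theta)$. Let $g=n/2$ if $n$ is even and $g=(n+1)/2$ if $n$ is odd. $\mathcal{L}_n^{e_1,\ldots,e_b}(X)$ (where $b\le N$ and $e_b<g$, or $e_b=g$ when $n=2e_b$) is the set of $\theta\in\mathcal{L}_n(X)$ with $e_i(X;\theta)=e_i$ for $1\le i\le b$ and, if $b<N$, $e_{b+1}(X;\theta)\ge g$. Convention: $e_0=0$. *)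

(* Defs.v *)
From HB Require Import structures.
From mathcomp Require Import all_boot all_order all_algebra.
From mathcomp Require Import boolp classical_sets.
From mathcomp Require Import mpoly.

Set Implicit Arguments.
Unset Strict Implicit.
Unset Printing Implicit Defensive.

Import GRing.Theory.
Local Open Scope classical_set_scope.
Local Open Scope ring_scope.

Record fps (R : Type) := Fps { fps_coef :> nat -> R }.

Notation "{ 'fps' R }" := (fps R) (at level 0, format "{ 'fps'  R }").

HB.instance Definition _ (R : Type) := gen_eqMixin {fps R}.
HB.instance Definition _ (R : Type) := gen_choiceMixin {fps R}.

Section FpsRing.
Variable R : comNzRingType.
Implicit Types a b c : {fps R}.

Lemma fpsP a b : (forall n, a n = b n) -> a = b.
Proof. by case: a b => [a] [b] /= eq_ab; congr Fps; apply: funext. Qed.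

Definition fps_const (x : R) : {fps R} := Fps (fun n => if n is 0 then x else 0).
Definition fps_Xn (e : nat) : {fps R} := Fps (fun n => (n == e)%:R).
Definition fps_add a b : {fps R} := Fps (fun n => a n + b n).
Definition fps_opp a : {fps R} := Fps (fun n => - a n).
Definition fps_mul a b : {fps R} :=
  Fps (fun n => \sum_(i < n.+1) a i * b (n - i)%N).

Definition fps_poly n a : {poly R} := \poly_(i < n.+1) a i.

Fact fps_addA : associative fps_add.
Proof. by move=> a b c; apply: fpsP => n /=; rewrite addrA. Qed.
Fact fps_addC : commutative fps_add.
Proof. by move=> a b; apply: fpsP => n /=; rewrite addrC. Qed.
Fact fps_add0 : left_id (fps_const 0) fps_add.
Proof. by move=> a; apply: fpsP => -[|n] /=; rewrite add0r. Qed.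
Fact fps_addN : left_inverse (fps_const 0) fps_opp fps_add.
Proof. by move=> a; apply: fpsP => -[|n] /=; rewrite addNr. Qed.
HB.instance Definition _ :=
  GRing.isZmodule.Build {fps R} fps_addA fps_addC fps_add0 fps_addN.

Lemma coef_fps_mul d n a b :
  (n <= d)%N -> fps_mul a b n = (fps_poly d a * fps_poly d b)`_n.
Proof.
move=> le_nd; rewrite coefM; apply: eq_bigr => i _.
have le_id : (i <= d)%N by apply: leq_trans le_nd; rewrite -ltnS.
have le_nid : (n - i <= d)%N by apply: leq_trans le_nd; exact: leq_subr.
by rewrite !coef_poly !ltnS le_id le_nid.
Qed.

Fact fps_mulC : commutative fps_mul.
Proof. by move=> a b; apply: fpsP => n; rewrite !(@coef_fps_mul n) // mulrC. Qed.

Lemma coef_fps_mul3 n a b c :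
  fps_mul (fps_mul a b) c n = (fps_poly n a * fps_poly n b * fps_poly n c)`_n.
Proof.
rewrite coefM; apply: eq_bigr => i _.
have le_in : (i <= n)%N by rewrite -ltnS.
by rewrite (coef_fps_mul a b le_in) [(fps_poly n c)`_ _]coef_poly ltnS leq_subr.
Qed.

Fact fps_mulA : associative fps_mul.
Proof.
move=> a b c; apply: fpsP => n.
rewrite fps_mulC !coef_fps_mul3.
by congr (_`_n); rewrite mulrC mulrA.
Qed.

Fact fps_mul1 : left_id (fps_const 1) fps_mul.
Proof.
move=> a; apply: fpsP => n /=; rewrite big_ord_recl /= mul1r subn0.
by rewrite big1 ?addr0 // => i _; rewrite mul0r.
Qed.

Fact fps_mulDl : left_distributive fps_mul fps_add.
Proof.
move=> a b c; apply: fpsP => n /=; rewrite -big_split.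
by apply: eq_bigr => i _; rewrite mulrDl.
Qed.

Fact fps_1neq0 : fps_const 1 != 0.
Proof. by apply/eqP => /(congr1 (fun a : {fps R} => a 0)) /eqP/=; rewrite oner_eq0. Qed.

HB.instance Definition _ := GRing.Zmodule_isComNzRing.Build {fps R}
  fps_mulA fps_mulC fps_mul1 fps_mulDl fps_1neq0.

End FpsRing.

(* An alias: the carrier {poly %/ 'X^(n.+1)} is already a module over R, whereas
   [tpoly R n] is a module over {fps R}. *)
Definition tpoly (R : comNzRingType) (n : nat) : Type :=
  {poly %/ ('X^(n.+1) : {poly R})}.

HB.instance Definition _ R n :=
  GRing.ComNzRing.copy (tpoly R n) {poly %/ ('X^(n.+1) : {poly R})}.

Definition tpoly_poly (R : comNzRingType) n (p : tpoly R n) : {poly R} :=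
  (p : {poly %/ ('X^(n.+1) : {poly R})}).

Definition tpoly_const (R : comNzRingType) n (x : R) : tpoly R n := qpolyC 'X^(n.+1) x.

Section FpsTrunc.
Variables (R : comNzRingType) (n : nat).
Implicit Types a b : {fps R}.

Definition fps_trunc a : tpoly R n := in_qpoly 'X^(n.+1) (fps_poly n a).

Lemma in_qpoly_take (p : {poly R}) :
  in_qpoly 'X^(n.+1) p = in_qpoly 'X^(n.+1) (take_poly n.+1 p).
Proof.
rewrite -{1}[p](poly_take_drop n.+1) in_qpolyD in_qpolyM.
suff -> : in_qpoly 'X^(n.+1) ('X^(n.+1) : {poly R}) = 0 by rewrite mulr0 addr0.
apply/val_inj; rewrite /= mk_monic_Xn.
exact: Pdiv.RingMonic.rmodpp (monicXn _ _).
Qed.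

Lemma fps_truncM a b : fps_trunc (a * b) = fps_trunc a * fps_trunc b.
Proof.
rewrite [RHS]/GRing.mul /= -[RHS]/(in_qpoly _ _ * in_qpoly _ _) -in_qpolyM.
rewrite [RHS]in_qpoly_take; congr in_qpoly; apply/polyP => i.
rewrite coef_take_poly coef_poly; case: ifP => // lt_i.
by rewrite (@coef_fps_mul R n).
Qed.

Lemma fps_truncD a b : fps_trunc (a + b) = fps_trunc a + fps_trunc b.
Proof.
rewrite -[RHS]in_qpolyD; congr in_qpoly; apply/polyP => i.
by rewrite coefD !coef_poly; case: ifP => //; rewrite addr0.
Qed.

Lemma fps_trunc1 : fps_trunc 1 = 1.
Proof.
rewrite -[RHS](@in_qpoly1 R 'X^(n.+1)); congr in_qpoly; apply/polyP => i.
by rewrite coef_poly coef1; case: i => [|i] //=; case: ifP.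
Qed.

Definition tpoly_scale a (p : tpoly R n) : tpoly R n := fps_trunc a * p.

Fact tpoly_scaleA a b p : tpoly_scale a (tpoly_scale b p) = tpoly_scale (a * b) p.
Proof. by rewrite /tpoly_scale fps_truncM mulrA. Qed.
Fact tpoly_scale1 : left_id 1 tpoly_scale.
Proof. by move=> p; rewrite /tpoly_scale fps_trunc1 mul1r. Qed.
Fact tpoly_scaleDr : right_distributive tpoly_scale +%R.
Proof. by move=> a p q; rewrite /tpoly_scale mulrDr. Qed.
Fact tpoly_scaleDl p : {morph tpoly_scale^~ p : a b / a + b}.
Proof. by move=> a b; rewrite /tpoly_scale fps_truncD mulrDl. Qed.

HB.instance Definition _ := GRing.Zmodule_isLmodule.Build {fps R} (tpoly R n)
  tpoly_scaleA tpoly_scale1 tpoly_scaleDr tpoly_scaleDl.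

End FpsTrunc.

Section QuotientModule.
Local Open Scope quotient_scope.
Variables (R : comNzRingType) (V : lmodType R) (n : nat) (g : 'I_n -> V).

Definition submod_gen : {pred V} :=
  fun v => `[< exists c : 'I_n -> R, v = \sum_i c i *: g i >].

Fact submod_gen_submod : submod_closed submod_gen.
Proof.
split; first by apply/asboolP; exists (fun=> 0); rewrite big1 // => i _; rewrite scale0r.
move=> a u v /asboolP[c ->] /asboolP[d ->]; apply/asboolP.
exists (fun i => a * c i + d i); rewrite scaler_sumr -big_split.
by apply: eq_bigr => i _; rewrite scalerDl scalerA.
Qed.

HB.instance Definition _ :=
  GRing.isZmodClosed.Build V submod_gen (GRing.submod_closedB submod_gen_submod).

Lemma submod_genZ a v : v \in submod_gen -> a *: v \in submod_gen.
Proof.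
by move=> Sv; rewrite -[a *: v]addr0 submod_gen_submod.2 // submod_gen_submod.1.
Qed.

Definition quot_mod : Type := Quotient.quot submod_gen.
HB.instance Definition _ := GRing.Zmodule.copy quot_mod (Quotient.quot submod_gen).

Definition quot_proj (v : V) : quot_mod := \pi_(Quotient.quot submod_gen) v.
Definition quot_repr (q : quot_mod) : V := repr (q : Quotient.quot submod_gen).

Lemma quot_reprK q : quot_proj (quot_repr q) = q.
Proof. exact: (@reprK _ (Quotient.quot submod_gen)). Qed.

Lemma eq_quot_proj u v : quot_proj u = quot_proj v <-> u - v \in submod_gen.
Proof.
by rewrite (Quotient.idealrBE submod_gen); split=> /eqP.
Qed.

Lemma quot_projD u v : quot_proj (u + v) = quot_proj u + quot_proj v.
Proof. exact: (raddfD (\pi_(Quotient.quot submod_gen))). Qed.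

Definition quot_scale a (q : quot_mod) : quot_mod := quot_proj (a *: quot_repr q).

Lemma quot_projZ a v : quot_proj (a *: v) = quot_scale a (quot_proj v).
Proof.
apply/eq_quot_proj; rewrite -scalerBr submod_genZ //.
by apply/eq_quot_proj; rewrite quot_reprK.
Qed.

Fact quot_scaleA a b q : quot_scale a (quot_scale b q) = quot_scale (a * b) q.
Proof. by rewrite -[q]quot_reprK -!quot_projZ scalerA. Qed.
Fact quot_scale1 : left_id 1 quot_scale.
Proof. by move=> q; rewrite -[q]quot_reprK -quot_projZ scale1r. Qed.
Fact quot_scaleDr : right_distributive quot_scale +%R.
Proof.
move=> a p q; rewrite -[p]quot_reprK -[q]quot_reprK.
by rewrite -quot_projD -!quot_projZ -quot_projD scalerDr.
Qed.
Fact quot_scaleDl q : {morph quot_scale^~ q : a b / a + b}.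
Proof.
by move=> a b; rewrite -[q]quot_reprK -!quot_projZ -quot_projD scalerDl.
Qed.

HB.instance Definition _ := GRing.Zmodule_isLmodule.Build R quot_mod
  quot_scaleA quot_scale1 quot_scaleDr quot_scaleDl.

End QuotientModule.

Definition lmod_iso (R : pzRingType) (U V : lmodType R) : Prop :=
  exists phi : {linear U -> V}, bijective phi.

(* k[[t]]/(t^e), which is 0 when e = 0; the ring {poly %/ 'X^e} would be k
   in that case. *)
Definition fps_mod (R : comNzRingType) (e : nat) : lmodType {fps R} :=
  quot_mod (fun _ : 'I_1 => fps_Xn R e : {fps R}^o).

(* (+)_(e <- s) k[[t]]/(t^e) (+) k[[t]]^r *)
Fixpoint elementary_module (R : comNzRingType) (s : seq nat) (r : nat) :
    lmodType {fps R} :=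
  if s is e :: s' then (fps_mod R e * elementary_module R s' r)%type
  else {ffun 'I_r -> {fps R}^o}.

(* Over an algebraically closed field, a locally closed subset of an affine
   space with its reduced structure is determined by its set of closed points,
   and a morphism between two of them is a map that is given locally by
   quotients of polynomials in the coordinates. *)

Record affine_space (k : fieldType) := AffineSpace {
  apoint :> Type;
  adim : nat;
  acoord : apoint -> 'rV[k]_adim;
  acoord_bij : bijective acoord
}.

Section Varieties.
Variable k : fieldType.

Definition affine (d : nat) : affine_space k :=
  @AffineSpace k 'rV[k]_d d id (Bijective (fun=> erefl) (fun=> erefl)).

Definition prod_coord (X Y : affine_space k) (z : X * Y) :
    'rV[k]_(adim X + adim Y) :=
  row_mx (acoord z.1) (acoord z.2).

Lemma prod_coord_bij X Y : bijective (@prod_coord X Y).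
Proof.
have [f fK Kf] := acoord_bij X; have [g gK Kg] := acoord_bij Y.
exists (fun v => (f (lsubmx v), g (rsubmx v))).
  by move=> [x y]; rewrite /prod_coord row_mxKl row_mxKr fK gK.
by move=> v; rewrite /prod_coord Kf Kg hsubmxK.
Qed.

Definition prod_space (X Y : affine_space k) : affine_space k :=
  AffineSpace (@prod_coord_bij X Y).

Definition poly_at (X : affine_space k) (p : {mpoly k[adim X]}) (x : X) : k :=
  p.@[acoord x 0].

Definition zariski_closed (X : affine_space k) (A : set X) : Prop :=
  exists P : set {mpoly k[adim X]}, A = [set x | forall p, P p -> poly_at p x = 0].

Definition zariski_open (X : affine_space k) (A : set X) : Prop :=
  zariski_closed (~` A).

Definition locally_closed (X : affine_space k) (A : set X) : Prop :=
  exists O C : set X, [/\ zariski_open O, zariski_closed C & A = O `&` C].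

Definition open_in (X : affine_space k) (A U : set X) : Prop :=
  exists2 O : set X, zariski_open O & U = A `&` O.

Definition regular_function (X : affine_space k) (A : set X) (h : X -> k) : Prop :=
  forall a, A a -> exists p q : {mpoly k[adim X]}, poly_at q a <> 0 /\
    forall x, A x -> poly_at q x <> 0 -> h x = poly_at p x / poly_at q x.

(* Only the values of [phi] on A matter. *)
Definition morphism (X Y : affine_space k) (A : set X) (B : set Y)
    (phi : X -> Y) : Prop :=
  (forall x, A x -> B (phi x)) /\
  forall j, regular_function A (fun x => acoord (phi x) 0 j).

Definition isomorphism (X Y : affine_space k) (A : set X) (B : set Y)
    (phi : X -> Y) : Prop :=
  morphism A B phi /\
  exists psi : Y -> X, [/\ morphism B A psi,
    forall x, A x -> psi (phi x) = x & forall y, B y -> phi (psi y) = y].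

Definition trivial_fibration (X Y F : affine_space k)
    (A : set X) (B : set Y) (C : set F) (p : X -> Y) : Prop :=
  exists phi : X -> prod_space Y F,
    isomorphism A (B `*` C : set (prod_space Y F)) phi /\
    forall x, A x -> (phi x).1 = p x.

Definition locally_trivial_fibration (X Y F : affine_space k)
    (A : set X) (B : set Y) (C : set F) (p : X -> Y) : Prop :=
  (forall x, A x -> B (p x)) /\
  forall b, B b -> exists V : set Y,
    [/\ open_in B V, V b & trivial_fibration (A `&` p @^-1` V) V C p].

End Varieties.

Section JetSpace.
Variables (k : fieldType) (N n : nat).

Definition jet_coord (theta : {ffun 'I_N -> tpoly k n}) : 'rV[k]_(N * n.+1) :=
  mxvec (\matrix_i poly_rV (tpoly_poly (theta i))).

Lemma jet_coord_bij : bijective jet_coord.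
Proof.
have szX : size (mk_monic ('X^(n.+1) : {poly k})) = n.+2.
  by rewrite mk_monic_Xn size_polyXn.
pose inv (v : 'rV[k]_(N * n.+1)) : {ffun 'I_N -> tpoly k n} :=
  [ffun i => in_qpoly 'X^(n.+1) (rVpoly (row i (vec_mx v)))].
exists inv.
  move=> theta; apply/ffunP => i; rewrite ffunE /jet_coord mxvecK rowK.
  apply/val_inj => /=.
  have sz : (size (tpoly_poly (theta i)) <= n.+1)%N.
    by rewrite -ltnS -szX; exact: size_mk_monic (theta i).
  by rewrite poly_rV_K // Pdiv.CommonRing.rmodp_small // size_mk_monic.
move=> v; rewrite /jet_coord -[RHS]vec_mxK; congr mxvec; apply/row_matrixP => i.
rewrite rowK ffunE /tpoly_poly in_qpoly_small ?rVpolyK //.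
by rewrite szX ltnS size_poly.
Qed.

Definition jet_space : affine_space k := AffineSpace jet_coord_bij.

End JetSpace.

Definition arc_space (k : fieldType) (N : nat) : Type := {ffun 'I_N -> {fps k}}.

Definition arc_trunc (k : fieldType) (N l : nat) (gamma : arc_space k N) :
    jet_space k N l :=
  [ffun i => fps_trunc l (gamma i)].

(* Reduction modulo t^(l+1), meant for l <= n. *)
Definition jet_trunc (k : fieldType) (N n l : nat) (theta : jet_space k N n) :
    jet_space k N l :=
  [ffun i => in_qpoly 'X^(l.+1) (tpoly_poly (theta i))].

Definition ideal_gen (k : fieldType) (N m : nat) (f : 'I_m -> {mpoly k[N]}) :
    set {mpoly k[N]} :=
  [set h | exists c : 'I_m -> {mpoly k[N]}, h = \sum_i c i * f i].

(* A closed subscheme of A^N is given by its ideal [IX]. *)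
Section JetsArcs.
Variables (k : fieldType) (N : nat) (IX : set {mpoly k[N]}).

Definition arcs : set (arc_space k N) :=
  [set gamma | forall h, IX h -> mmap (@fps_const k) gamma h = 0].

Definition jets (n : nat) : set (jet_space k N n) :=
  [set theta | forall h, IX h ->
     mmap (@tpoly_const k n) (theta : {ffun 'I_N -> tpoly k n}) h = 0].

Variables (m : nat) (f : 'I_m -> {mpoly k[N]}).

Definition arc_jacobian (gamma : arc_space k N) (i : 'I_m) :
    {ffun 'I_N -> {fps k}^o} :=
  [ffun j => mmap (@fps_const k) gamma (mderiv j (f i))].

Definition jet_jacobian (n : nat) (theta : jet_space k N n) (i : 'I_m) :
    {ffun 'I_N -> tpoly k n} :=
  [ffun j => mmap (@tpoly_const k n) (theta : {ffun 'I_N -> tpoly k n})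
               (mderiv j (f i))].

(* The sequence (e_1, ..., e_p) attached to gamma is unique, so "the sequence of
   gamma is e" is stated as a relation; likewise for jets. It is computed from
   the generators f of [IX] but does not depend on their choice. *)
Definition arc_invariants (gamma : arc_space k N) (e : seq nat) : Prop :=
  [/\ sorted leq e, (size e <= minn m N)%N &
      lmod_iso (quot_mod (arc_jacobian gamma))
               (elementary_module k e (N - size e))].

Definition jet_invariants (n : nat) (theta : jet_space k N n) (s : seq nat) : Prop :=
  [/\ size s = N, sorted leq s, (forall e, e \in s -> (e <= n.+1)%N) &
      lmod_iso (quot_mod (jet_jacobian theta)) (elementary_module k s 0)].

Definition arc_stratum (e : seq nat) : set (arc_space k N) :=
  [set gamma | arcs gamma /\ arc_invariants gamma e].

(* Meant for b := size e <= N and e_b < g, or e_b = g when n = 2 e_b. *)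
Definition jet_stratum (n : nat) (e : seq nat) : set (jet_space k N n) :=
  let g := if odd n then n.+1./2 else n./2 in
  [set theta | jets theta /\ exists s : seq nat,
     [/\ jet_invariants theta s,
         forall i, (i < size e)%N -> nth 0%N s i = nth 0%N e i &
         (size e < N)%N -> (g <= nth 0%N s (size e))%N]].

Definition arc_stratum_image (l : nat) (e : seq nat) : set (jet_space k N l) :=
  @arc_trunc k N l @` arc_stratum e.

End JetsArcs.

Arguments ideal_gen {k N m} f.
Arguments jet_stratum {k N} IX {m} f n e.
Arguments arc_stratum_image {k N} IX {m} f l e.
Arguments arc_trunc {k N} l gamma.
Arguments jet_trunc {k N n} l theta.

(* Main.v *)
From HB Require Import structures.
Require Import Defs.
From mathcomp Require Import all_boot all_order all_algebra perm.
From mathcomp Require Import boolp classical_sets.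
From mathcomp Require Import mpoly ring.

Set Implicit Arguments.
Unset Strict Implicit.
Unset Printing Implicit Defensive.

Import GRing.Theory.
Local Open Scope classical_set_scope.
Local Open Scope ring_scope.

(** Write R for k[[t]], J for the m x N Jacobian matrix of f at an arc and e_m
    for the last term of e. The invariants of an arc or of a jet are e exactly
    when J, computed on any lift of the jet, is equivalent over R to the
    rectangular diagonal matrix with entries t^(e_i) ([arc_invariantsP],
    [jet_invariantsP]). One direction is an explicit presentation of the
    quotient module; for the other, a Smith normal form of J exists
    ([smith_normal_form]) and the k-dimensions of t^j M / t^(j+1) M determine the
    exponents ([elementary_module_inj]).

    Such a J satisfies J K = t^(e_m) for some K, so changing the arc modulo
    t^(e_m + 1) multiplies J on the right by a matrix congruent to 1 modulo t
    ([type_perturb]): the type of J and its image in R^m only depend on the jet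
    of order e_m. Taylor's formula f(a + t^s x) = f(a) + t^s J x + t^(2s) Q(x) and
    the completeness of R then give a Newton iteration ([hensel]), and hence the
    criterion on which everything rests ([arc_stratum_imageP]): for l >= e_m, the
    l-jet of an arc a lifts to the stratum iff J(a) has type e and f(a) lies in
    t^(l+1) J(a) R^N.

    Part (a). An (l+i)-jet of the stratum has f(a) = 0 modulo t^(l+i+1), and
    t^i R^m is contained in J R^N when i >= e_m, so the criterion holds at
    order l. The criterion is a locally closed condition: the type of J is
    expressed by the orders of the ideals of its r-minors ([smith_minorsP]), and,
    when the columns chosen by g carry a minor of least order
    E = e_1 + ... + e_m, membership of f(a) in t^(l+1) J R^N means that
    adj(J_g) f(a) vanishes to order E + l + 1 ([column_space_minors]).

    Parts (b) and (c). Choose such columns g. The locus where the minor of J_g has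
    order E is open and is pulled back from order e_m; on it J = J_g C. For an
    l-jet a in this chart, the jets a + t^(l+1) x above it that stay in the
    stratum are those for which the coefficient of t^(E + l + 1) in
    adj(J_g) (f(a) + t^(l+1) J x) vanishes ([liftable_step]). This is an affine
    system in x in which each coordinate of x indexed by g occurs in one equation
    only, with the same invertible coefficient ([obstruction_columns]). So the
    N - m other coordinates are free and the system expresses those indexed by g
    as regular functions ([chart_fibration]). Composing these trivialisations
    gives (c). *)

(** * Power series over a field *)

Section PowerSeries.
Variable k : fieldType.
Local Notation R := {fps k}.
Implicit Types (a b : R) (s n : nat).

Lemma coef_fpsD a b n : (a + b) n = a n + b n. Proof. by []. Qed.
Lemma coef_fpsB a b n : (a - b) n = a n - b n. Proof. by []. Qed.
Lemma coef_fps0 n : (0 : R) n = 0. Proof. by case: n. Qed.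
Lemma coef_fpsM a b n : (a * b) n = \sum_(i < n.+1) a i * b (n - i)%N.
Proof. by []. Qed.

Lemma coef_fps_sum I (r : seq I) (P : pred I) (F : I -> R) n :
  (\sum_(i <- r | P i) F i) n = \sum_(i <- r | P i) F i n.
Proof. by elim/big_rec2: _ => [|i x y _ <-]; rewrite ?coef_fps0. Qed.

Lemma coef_fpsXnM s a n :
  (fps_Xn k s * a) n = if (n < s)%N then 0 else a (n - s)%N.
Proof.
rewrite coef_fpsM /=; case: ltnP => [lt_ns|le_sn].
  rewrite big1 // => i _; rewrite (_ : (i == s :> nat) = false) ?mul0r //.
  by apply/negP => /eqP eq_is; have := ltn_ord i; rewrite eq_is ltnS leqNgt lt_ns.
rewrite (bigD1 (Ordinal (le_sn : (s < n.+1)%N))) //= eqxx mul1r.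
by rewrite big1 ?addr0 // => i /negPf ne_i; rewrite -val_eqE /= in ne_i; rewrite ne_i mul0r.
Qed.

Lemma coef_fpsCM (x : k) a n : (fps_const x * a) n = x * a n.
Proof.
rewrite coef_fpsM big_ord_recl /= subn0 big1 ?addr0 // => i _.
by rewrite mul0r.
Qed.

Lemma fps_XnD s s' : fps_Xn k (s + s') = fps_Xn k s * fps_Xn k s'.
Proof.
apply: fpsP => n; rewrite coef_fpsXnM /=; case: ltnP => h.
  by rewrite (_ : (n == (s + s')%N) = false) //; apply/negP => /eqP e; rewrite e ltnNge leq_addr in h.
by rewrite -[in RHS](eqn_add2l s) subnKC.
Qed.

Lemma fps_Xn0 : fps_Xn k 0 = 1. Proof. by apply: fpsP => -[|n]. Qed.

Lemma fps_XnI s : injective (fun a => fps_Xn k s * a).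
Proof.
move=> a b /= eq_ab; apply: fpsP => n.
have := congr1 (fun c : R => c (s + n)%N) eq_ab.
by rewrite !coef_fpsXnM ltnNge leq_addr /= addKn.
Qed.

Definition fps_dvd s a : Prop := exists b, a = fps_Xn k s * b.

Lemma fps_dvdP s a : fps_dvd s a <-> forall n, (n < s)%N -> a n = 0.
Proof.
split=> [[b ->] n lt_ns|a0]; first by rewrite coef_fpsXnM lt_ns.
exists (Fps (fun n => a (s + n)%N)); apply: fpsP => n.
by rewrite coef_fpsXnM /=; case: ltnP => [/a0 //|le_sn]; rewrite subnKC.
Qed.

Lemma fps_dvdS s a : fps_dvd s a -> a s = 0 -> fps_dvd s.+1 a.
Proof.
move=> /fps_dvdP as0 a0; apply/fps_dvdP => n.
by rewrite ltnS leq_eqVlt => /predU1P[->//|/as0].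
Qed.

Lemma fps_dvdW s s' a : (s' <= s)%N -> fps_dvd s a -> fps_dvd s' a.
Proof.
move=> le_s /fps_dvdP a0; apply/fps_dvdP => n lt_n; apply: a0.
exact: leq_trans lt_n le_s.
Qed.

Lemma fps_dvd0 s : fps_dvd s 0. Proof. by exists 0; rewrite mulr0. Qed.

Lemma fps_dvdD s a b : fps_dvd s a -> fps_dvd s b -> fps_dvd s (a + b).
Proof. by move=> [c ->] [d ->]; exists (c + d); rewrite mulrDr. Qed.

Lemma fps_dvdMl s a b : fps_dvd s b -> fps_dvd s (a * b).
Proof. by move=> [d ->]; exists (a * d); rewrite mulrCA. Qed.

Lemma fps_dvd_sum s I (r : seq I) (P : pred I) (F : I -> R) :
  (forall i, P i -> fps_dvd s (F i)) -> fps_dvd s (\sum_(i <- r | P i) F i).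
Proof. by move=> dvdF; apply: big_ind => //; [exact: fps_dvd0 | exact: fps_dvdD]. Qed.

Lemma fps_dvd_Xn s s' : fps_dvd s (fps_Xn k s') <-> (s <= s')%N.
Proof.
split=> [/fps_dvdP X0|le_s].
  rewrite leqNgt; apply/negP => /X0 /=; rewrite eqxx => /eqP.
  by rewrite oner_eq0.
by apply/fps_dvdP => n lt_ns /=; rewrite ltn_eqF // (leq_trans lt_ns).
Qed.

Fact fps_const_additive : {morph @fps_const k : x y / x - y}.
Proof. by move=> x y; apply: fpsP => -[|n]; rewrite coef_fpsB //= subr0. Qed.
Fact fps_const_multiplicative :
  (fps_const 1 = 1 :> R) * {morph @fps_const k : x y / x * y}.
Proof.
split=> // x y; apply: fpsP => n; rewrite coef_fpsCM.
by case: n => //= n; rewrite mulr0.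
Qed.
HB.instance Definition _ := GRing.isZmodMorphism.Build k R _ fps_const_additive.
HB.instance Definition _ :=
  GRing.isMonoidMorphism.Build k R _ fps_const_multiplicative.

Definition fps_at0 a : k := a 0%N.
Fact fps_at0_additive : {morph fps_at0 : a b / a - b}. Proof. by []. Qed.
Fact fps_at0_multiplicative : (fps_at0 1 = 1) * {morph fps_at0 : a b / a * b}.
Proof. by split=> // a b; rewrite /fps_at0 coef_fpsM big_ord1. Qed.
HB.instance Definition _ := GRing.isZmodMorphism.Build R k _ fps_at0_additive.
HB.instance Definition _ :=
  GRing.isMonoidMorphism.Build R k _ fps_at0_multiplicative.

Lemma fps_dvd1 a : fps_dvd 1 a <-> fps_at0 a = 0.
Proof. by split=> [/fps_dvdP dvd_a|a0]; [exact: dvd_a | apply/fps_dvdP => -[]]. Qed.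

Definition fps_eqmod s a b : Prop := forall n, (n < s)%N -> a n = b n.

Lemma fps_eqmodP s a b : fps_eqmod s a b <-> fps_dvd s (a - b).
Proof.
split=> [eq_ab|/fps_dvdP ab0 n /ab0/eqP].
  by apply/fps_dvdP => n lt_ns; rewrite coef_fpsB (eq_ab n lt_ns) subrr.
by rewrite coef_fpsB subr_eq0 => /eqP.
Qed.

(** k[[t]] is complete: the iterates of a map that gains one power of t at each
   step stabilise coefficientwise, and their limit is a fixed point. *)
Lemma fps_contraction_fixpoint (I : Type) (G : (I -> R) -> I -> R) :
  (forall s (x y : I -> R), (forall i, fps_eqmod s (x i) (y i)) ->
     forall i, fps_eqmod s.+1 (G x i) (G y i)) ->
  exists x, forall i, G x i = x i.
Proof.
move=> contrG; pose u s := iter s G (fun=> 0).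
have uS s i : fps_eqmod s (u s i) (u s.+1 i).
  by elim: s i => [|s IHs] i //; apply: contrG.
have u_stable s s' i : (s <= s')%N -> fps_eqmod s (u s i) (u s' i).
  elim: s' => [|s' IHs']; first by rewrite leqn0 => /eqP->.
  rewrite leq_eqVlt => /predU1P[->//|le_ss'] n lt_ns.
  by rewrite IHs' // uS //; exact: leq_trans lt_ns le_ss'.
pose x i := Fps (fun n => u n.+1 i n).
have x_u s i : fps_eqmod s (x i) (u s i).
  by move=> n lt_ns /=; apply: (u_stable n.+1 s).
exists x => i; apply: fpsP => n.
rewrite (contrG _ _ _ (x_u n.+1) i n (leqW (leqnn _))) -[G _]/(u n.+2).
by apply/esym; apply: (u_stable n.+1 n.+2).
Qed.

Lemma fps_unit a : fps_at0 a != 0 -> exists b, a * b = 1.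
Proof.
move=> a0_neq0; pose c := fps_const (fps_at0 a)^-1.
have ca1 : fps_dvd 1 (1 - c * a).
  by apply/fps_dvd1; rewrite rmorphB rmorphM rmorph1 /= mulVf ?subrr.
(* A fixed point of x |-> c + (1 - c a) x satisfies c a x = c. *)
pose G (x : unit -> R) (i : unit) := c + (1 - c * a) * x i.
have [|x fix_x] := @fps_contraction_fixpoint _ G.
  move=> s x y eq_xy i; apply/fps_eqmodP; rewrite /G opprD addrACA subrr add0r -mulrBr.
  have [d ->] := ca1; have /fps_eqmodP[d' ->] := eq_xy i.
  by exists (d * d'); rewrite -[s.+1]add1n fps_XnD mulrACA.
exists (x tt); have /eqP := fix_x tt.
rewrite /G mulrBl mul1r addrCA -subr_eq0 addrAC subrr add0r subr_eq0 => /eqP cax.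
have Cc : fps_const (fps_at0 a) * c = 1 by rewrite -rmorphM divff ?rmorph1.
by rewrite -[a]mul1r -Cc -!mulrA [c * _]mulrA -cax Cc.
Qed.

End PowerSeries.

(** * Matrices over k[[t]] and their Smith normal form *)

Section MatrixEquivalence.
Variable R : comNzRingType.

Definition mx_invertible n (V : 'M[R]_n) : Prop := exists V', V *m V' = 1%:M.

Lemma mx_invertible1 n : mx_invertible (1%:M : 'M[R]_n).
Proof. by exists 1%:M; rewrite mulmx1. Qed.

Lemma mx_invertibleM n (U V : 'M[R]_n) :
  mx_invertible U -> mx_invertible V -> mx_invertible (U *m V).
Proof.
move=> [U' UU'] [V' VV']; exists (V' *m U').
by rewrite -mulmxA (mulmxA V) VV' mul1mx.
Qed.

Lemma mx_invertible_det n (V : 'M[R]_n) :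
  mx_invertible V <-> exists c, \det V * c = 1.
Proof.
split=> [[V' VV']|[c Vc]]; first by exists (\det V'); rewrite -det_mulmx VV' det1.
by exists (c *: \adj V); rewrite -scalemxAr mul_mx_adj scale_scalar_mx mulrC Vc.
Qed.

Lemma mx_invertible_block m n (U : 'M[R]_m) (V : 'M[R]_n) :
  mx_invertible U -> mx_invertible V -> mx_invertible (block_mx U 0 0 V).
Proof.
move=> [U' UU'] [V' VV']; exists (block_mx U' 0 0 V').
by rewrite mulmx_block !mul0mx !mulmx0 !addr0 !add0r UU' VV' -scalar_mx_block.
Qed.

Definition mx_equiv m n (A B : 'M[R]_(m, n)) : Prop :=
  exists U V, [/\ mx_invertible U, mx_invertible V & A = U *m B *m V].

Lemma mx_equiv_refl m n (A : 'M[R]_(m, n)) : mx_equiv A A.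
Proof.
exists 1%:M, 1%:M; rewrite mul1mx mulmx1.
by split=> //; apply: mx_invertible1.
Qed.

Lemma mx_equiv_trans m n (A B C : 'M[R]_(m, n)) :
  mx_equiv A B -> mx_equiv B C -> mx_equiv A C.
Proof.
move=> [U [V [iU iV ->]]] [U1 [V1 [iU1 iV1 ->]]]; exists (U *m U1), (V1 *m V).
by split; [exact: mx_invertibleM | exact: mx_invertibleM | rewrite !mulmxA].
Qed.

Lemma mx_equiv_sym m n (A B : 'M[R]_(m, n)) : mx_equiv A B -> mx_equiv B A.
Proof.
move=> [U [V [[U' UU'] [V' VV'] ->]]]; exists U', V'; split.
- by exists U; rewrite (mulmx1C UU').
- by exists V; rewrite (mulmx1C VV').
by rewrite !mulmxA (mulmx1C UU') mul1mx -mulmxA VV' mulmx1.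
Qed.

Lemma mx_equiv_scale m n (A B : 'M[R]_(m, n)) c :
  mx_equiv A B -> mx_equiv (c *: A) (c *: B).
Proof.
move=> [U [V [iU iV ->]]]; exists U, V; split=> //.
by rewrite -scalemxAr -scalemxAl.
Qed.

(** Row and column operations with a unit pivot leave its Schur complement. *)
Lemma mx_equiv_pivot m n (A : 'M[R]_(1 + m, 1 + n)) u :
  A 0 0 * u = 1 -> exists S : 'M_(m, n), mx_equiv A (block_mx 1%:M 0 0 S).
Proof.
move=> Au; pose a := ulsubmx A; pose r := ursubmx A.
pose c := dlsubmx A; pose B := drsubmx A.
have aE : a = (A 0 0)%:M.
  by rewrite [LHS]mx11_scalar !mxE; congr (A _ _)%:M; apply/val_inj.
exists (B - u *: (c *m r)).
exists (block_mx a 0 c 1%:M), (block_mx 1%:M (u *: r) 0 1%:M); split.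
- apply/mx_invertible_det; exists u.
  by rewrite det_lblock det1 mulr1 aE det_scalar1.
- by exists (block_mx 1%:M (- (u *: r)) 0 1%:M); rewrite mulmx_block
    !mul1mx !mulmx1 !mulmx0 !mul0mx !addr0 add0r addNr -scalar_mx_block.
rewrite !mulmx_block !mul1mx !mulmx1 !mulmx0 !mul0mx !addr0 !add0r.
rewrite -!scalemxAr aE mul_scalar_mx scalerA mulrC Au scale1r addrC subrK.
by rewrite -aE submxK.
Qed.

End MatrixEquivalence.

Section Smith.
Variable k : fieldType.
Local Notation R := {fps k}.

Definition smith_mx m n (e : seq nat) : 'M[R]_(m, n) :=
  \matrix_(i, j) if (i == j :> nat) && (i < size e)%N
                 then fps_Xn k (nth 0%N e i) else 0.

Lemma smith_mx0 m n : smith_mx m n [::] = 0.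
Proof. by apply/matrixP => i j; rewrite !mxE andbF. Qed.

Lemma smith_mx_cons0 m n e :
  smith_mx (1 + m) (1 + n) (0%N :: e) = block_mx 1%:M 0 0 (smith_mx m n e).
Proof.
apply/matrixP => i j; rewrite !mxE.
case: splitP => i' /= ->; rewrite !mxE; case: splitP => j' /= ->; rewrite !mxE /=.
- by rewrite !ord1 /= fps_Xn0.
- by rewrite ord1.
- by rewrite ord1.
- by rewrite add1n.
Qed.

Lemma smith_mx_scale m n v e :
  (size e <= m)%N -> fps_Xn k v *: smith_mx m n e = smith_mx m n (map (addn v) e).
Proof.
move=> sz_e; apply/matrixP => i j; rewrite !mxE size_map.
case: ifP => [/andP[_ lt_i]|_]; last by rewrite mulr0.
by rewrite (nth_map 0%N) // fps_XnD.
Qed.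

Lemma fps_min_order m n (A : 'M[R]_(m, n)) :
  A != 0 -> exists v (B : 'M[R]_(m, n)), A = fps_Xn k v *: B /\
    exists i j, fps_at0 (B i j) != 0.
Proof.
move=> A_neq0.
have exA : exists v, [exists i, exists j, A i j v != 0].
  apply: contrapT => /forallNP noA; case/eqP: A_neq0; apply/matrixP => i j.
  apply: fpsP => v; rewrite mxE coef_fps0; apply: contrapT => /eqP Av.
  by case: (noA v); apply/existsP; exists i; apply/existsP; exists j.
case: (ex_minnP exA) => v /existsP[i /existsP[j Aij]] min_v.
exists v, (\matrix_(i, j) Fps (fun n => A i j (v + n)%N)); split.
  apply/matrixP => i1 j1; apply: fpsP => s; rewrite !mxE coef_fpsXnM /=.
  case: ltnP => [lt_sv|le_vs]; last by rewrite subnKC.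
  apply: contrapT => /eqP A1.
  have /min_v : [exists i, exists j, A i j s != 0].
    by apply/existsP; exists i1; apply/existsP; exists j1.
  by rewrite leqNgt lt_sv.
by exists i, j; rewrite mxE /fps_at0 /= addn0.
Qed.

Lemma mx_equiv_xrow m n (A : 'M[R]_(m, n)) i j : mx_equiv (xrow i j A) A.
Proof.
exists (tperm_mx i j), 1%:M; split; last by rewrite xrowE mulmx1.
  by exists (tperm_mx i j); rewrite /tperm_mx -perm_mxM tperm2 perm_mx1.
exact: mx_invertible1.
Qed.

Lemma mx_equiv_xcol m n (A : 'M[R]_(m, n)) i j : mx_equiv (xcol i j A) A.
Proof.
exists 1%:M, (tperm_mx i j); split; last by rewrite xcolE mul1mx.
  exact: mx_invertible1.
by exists (tperm_mx i j); rewrite /tperm_mx -perm_mxM tperm2 perm_mx1.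
Qed.

(** Gaussian elimination: in a discrete valuation ring, an entry of minimal
    order divides all the others, so it can serve as pivot. *)
Theorem smith_normal_form m n (A : 'M[R]_(m, n)) :
  exists e, [/\ sorted leq e, (size e <= minn m n)%N & mx_equiv A (smith_mx m n e)].
Proof.
elim: m n A => [|m IHm] n A.
  exists [::]; split=> //; rewrite smith_mx0 (flatmx0 A); exact: mx_equiv_refl.
case: n A => [|n] A.
  exists [::]; split=> //; rewrite smith_mx0 (thinmx0 A); exact: mx_equiv_refl.
have [->|/fps_min_order[v [B [-> [i [j Bij]]]]]] := eqVneq A 0.
  by exists [::]; split=> //; rewrite smith_mx0; exact: mx_equiv_refl.
pose C : 'M[R]_(1 + m, 1 + n) := xrow i 0 (xcol j 0 B).
have C00 : C 0 0 = B i j by rewrite !mxE !tpermR.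
have [u Cu] : exists u, C 0 0 * u = 1 by apply: fps_unit; rewrite C00.
have [S CS] := mx_equiv_pivot Cu.
have [e [sorted_e size_e Se]] := IHm _ S.
exists (map (addn v) (0%N :: e)); split.
- have : sorted leq (0%N :: e) by case: e sorted_e {size_e Se}.
  by rewrite sorted_map; apply: sub_sorted => x y /=; rewrite leq_add2l.
- by rewrite size_map /= minnSS.
have sz_e : (size (0%N :: e) <= m.+1)%N.
  by rewrite ltnS (leq_trans size_e) // geq_minl.
rewrite -(smith_mx_scale n.+1 v sz_e); apply: mx_equiv_scale.
have BC : mx_equiv B C.
  apply: mx_equiv_sym; apply: mx_equiv_trans (mx_equiv_xcol B j 0).
  exact: mx_equiv_xrow.
apply: mx_equiv_trans BC (mx_equiv_trans CS _).
have [U [V [iU iV ->]]] := Se.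
rewrite (smith_mx_cons0 m n e).
exists (block_mx 1%:M 0 0 U), (block_mx 1%:M 0 0 V); split.
- by apply: mx_invertible_block => //; exact: mx_invertible1.
- by apply: mx_invertible_block => //; exact: mx_invertible1.
by rewrite !(mulmx_block, mul1mx, mulmx1, mulmx0, mul0mx, addr0, add0r).
Qed.

End Smith.

(** * Minors *)

Section Minors.
Variable k : fieldType.
Local Notation R := {fps k}.

(** The terms of the Cauchy-Binet formula before those with the same image of g
    are collected; enough to see that minors of a product are combinations of
    minors of a factor. *)
Lemma det_mulmx_rect (S : comNzRingType) r n (A : 'M[S]_(r, n)) (B : 'M[S]_(n, r)) :
  \det (A *m B) =
  \sum_(g : {ffun 'I_r -> 'I_n}) (\prod_i A i (g i)) * \det (rowsub g B).
Proof.
rewrite /determinant.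
under eq_bigr => s _.
  under eq_bigr => i _ do rewrite mxE.
  rewrite bigA_distr_bigA mulr_sumr /=; over.
rewrite exchange_big; apply: eq_bigr => g _; rewrite mulr_sumr.
apply: eq_bigr => s _; rewrite big_split /= mulrCA; congr (_ * (_ * _)).
by apply: eq_bigr => i _; rewrite mxE.
Qed.

Definition minors_dvd r d m n (A : 'M[R]_(m, n)) : Prop :=
  forall (f : 'I_r -> 'I_m) (g : 'I_r -> 'I_n), fps_dvd d (\det (mxsub f g A)).

Lemma minors_dvdM r d m n m' n' (U : 'M_(m', m)) (A : 'M[R]_(m, n)) (V : 'M_(n, n')) :
  minors_dvd r d A -> minors_dvd r d (U *m A *m V).
Proof.
move=> dvdA f g.
have -> : mxsub f g (U *m A *m V) = rowsub f U *m (A *m colsub g V).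
  rewrite -mulmxA; apply/matrixP => i j; rewrite !mxE; apply: eq_bigr => l _.
  rewrite !mxE; congr (_ * _); apply: eq_bigr => l' _; by rewrite !mxE.
rewrite det_mulmx_rect; apply: fps_dvd_sum => h _; apply: fps_dvdMl.
have -> : rowsub h (A *m colsub g V) = ((colsub g V)^T *m (rowsub h A)^T)^T.
  rewrite trmx_mul !trmxK; apply/matrixP => i j; rewrite !mxE.
  by apply: eq_bigr => l' _; rewrite !mxE.
rewrite det_tr det_mulmx_rect; apply: fps_dvd_sum => h' _; apply: fps_dvdMl.
have -> : rowsub h' (rowsub h A)^T = (mxsub h h' A)^T.
  by apply/matrixP => i j; rewrite !mxE.
by rewrite det_tr; exact: dvdA.
Qed.

Lemma minors_dvd_equiv r d m n (A B : 'M[R]_(m, n)) :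
  mx_equiv A B -> minors_dvd r d B -> minors_dvd r d A.
Proof. by move=> [U [V [_ _ ->]]]; exact: minors_dvdM. Qed.

Lemma minors_dvdW r d d' m n (A : 'M[R]_(m, n)) :
  (d' <= d)%N -> minors_dvd r d A -> minors_dvd r d' A.
Proof. by move=> le_d dvdA f g; exact: fps_dvdW (dvdA f g). Qed.

Lemma sumn_take_nth (e : seq nat) r :
  (r <= size e)%N -> sumn (take r e) = \sum_(i < r) nth 0%N e i.
Proof.
move=> le_r; rewrite sumnE (big_nth 0%N) size_takel // big_mkord.
by apply: eq_bigr => i _; rewrite nth_take.
Qed.

(** Once the chosen indices are sorted increasingly, the i-th one is at least i. *)
Lemma leq_sumn_take (e : seq nat) r (f : 'I_r -> nat) :
    sorted leq e -> injective f -> (forall i, f i < size e)%N ->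
  (sumn (take r e) <= \sum_i nth 0%N e (f i))%N.
Proof.
move=> sorted_e inj_f lt_f; pose s := sort leq [seq f i | i : 'I_r].
have perm_s : perm_eq s [seq f i | i : 'I_r] by rewrite perm_sort.
have size_s : size s = r by rewrite (perm_size perm_s) size_map size_enum_ord.
have sorted_s : sorted ltn s.
  rewrite ltn_sorted_uniq_leq (perm_uniq perm_s) map_inj_uniq ?enum_uniq //.
  by apply: sort_sorted; exact: leq_total.
have lt_s i : (i < r)%N -> (nth 0%N s i < size e)%N.
  move=> lt_ir; have : nth 0%N s i \in s by rewrite mem_nth ?size_s.
  by rewrite (perm_mem perm_s) => /mapP[j _ ->].
have ge_s i : (i < r)%N -> (i <= nth 0%N s i)%N.
  elim: i => // i IHi lt_ir; apply: leq_ltn_trans (IHi (ltnW lt_ir)) _.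
  by apply: (sorted_ltn_nth ltn_trans) => //; rewrite inE size_s // ltnW.
have le_r : (r <= size e)%N.
  have : injective (fun i => Ordinal (lt_f i)) by move=> i j /(congr1 val) /inj_f.
  by move/leq_card; rewrite !card_ord.
rewrite sumn_take_nth //.
have -> : (\sum_i nth 0%N e (f i) = \sum_(x <- s) nth 0%N e x)%N.
  by rewrite (perm_big _ perm_s) big_map big_enum.
rewrite (big_nth 0%N) size_s big_mkord; apply: leq_sum => i _.
apply: (sorted_leq_nth leq_trans leqnn) => //; rewrite ?inE ?lt_s ?ge_s //.
exact: leq_trans le_r.
Qed.

Lemma fps_dvd_prod I (r : seq I) (d : I -> nat) (F : I -> R) :
  (forall i, fps_dvd (d i) (F i)) ->
  fps_dvd (\sum_(i <- r) d i)%N (\prod_(i <- r) F i).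
Proof.
move=> dvdF; elim/big_rec2: _ => [|i n a _ [b ->]]; first by exists 1; rewrite fps_Xn0 mulr1.
by have [c ->] := dvdF i; exists (c * b); rewrite fps_XnD mulrACA.
Qed.

Lemma prod_fps_Xn I (r : seq I) (d : I -> nat) :
  \prod_(i <- r) fps_Xn k (d i) = fps_Xn k (\sum_(i <- r) d i)%N.
Proof. by elim/big_rec2: _ => [|i a n _ ->]; rewrite ?fps_Xn0 ?fps_XnD. Qed.

Lemma det_not_inj r m n (A : 'M[R]_(m, n)) (f : 'I_r -> 'I_m) (g : 'I_r -> 'I_n) :
  ~ injective f -> \det (mxsub f g A) = 0.
Proof.
move=> ninj_f; have /injectivePn[i [j ne_ij eq_f]] : ~~ injectiveb f.
  by apply/injectiveP.
by apply: (determinant_alternate ne_ij) => l; rewrite !mxE eq_f.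
Qed.

(** When the chosen rows are distinct, a nonzero term of the Leibniz expansion is
    a product of r distinct diagonal entries; otherwise the minor is 0. *)
Lemma minors_dvd_smith r m n (e : seq nat) :
  sorted leq e -> minors_dvd r (sumn (take r e)) (smith_mx k m n e).
Proof.
move=> sorted_e f g; have [inj_f|] := pselect (injective f); last first.
  by move/(det_not_inj (smith_mx k m n e) g) => ->; exact: fps_dvd0.
rewrite /determinant; apply: fps_dvd_sum => s _; apply: fps_dvdMl.
have [[i le_i]|lt_f] := pselect (exists i, (size e <= f i)%N).
  rewrite (bigD1 i) //= !mxE ltnNge le_i andbF mul0r; exact: fps_dvd0.
apply: (@fps_dvdW _ (\sum_(i < r) nth 0%N e (f i))%N).
  apply: (@leq_sumn_take e r (fun i => f i)) => //.
    by move=> i j /val_inj /inj_f.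
  by move=> i; rewrite ltnNge; apply/negP => le_i; apply: lt_f; exists i.
apply: fps_dvd_prod => i; rewrite !mxE; case: ifP => _; last exact: fps_dvd0.
exact/fps_dvd_Xn.
Qed.

(** More rows than nonzero diagonal entries: one of the rows is zero. *)
Lemma minors_dvd_smith_big r d m n (e : seq nat) :
  (size e < r)%N -> minors_dvd r d (smith_mx k m n e).
Proof.
move=> lt_er f g; have [inj_f|] := pselect (injective f); last first.
  by move/(det_not_inj (smith_mx k m n e) g) => ->; exact: fps_dvd0.
have [i le_i] : exists i, (size e <= f i)%N.
  apply: contrapT => /forallNP lt_f.
  have lt_fe i : (f i < size e)%N by rewrite ltnNge; apply/negP; exact: lt_f.
  have : injective (fun i => Ordinal (lt_fe i)).
    by move=> i j /(congr1 val) /= /val_inj /inj_f.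
  by move/leq_card; rewrite !card_ord leqNgt lt_er.
rewrite /determinant; apply: fps_dvd_sum => s _; apply: fps_dvdMl.
rewrite (bigD1 i) //= !mxE ltnNge le_i andbF mul0r; exact: fps_dvd0.
Qed.

Lemma minors_smith_attained r m n (e : seq nat) :
    (r <= size e)%N -> (r <= m)%N -> (r <= n)%N ->
  ~ minors_dvd r (sumn (take r e)).+1 (smith_mx k m n e).
Proof.
move=> le_re le_rm le_rn /(_ (widen_ord le_rm) (widen_ord le_rn)).
have -> : mxsub (widen_ord le_rm) (widen_ord le_rn) (smith_mx k m n e) =
          diag_mx (\row_i fps_Xn k (nth 0%N e i)).
  apply/matrixP => i j; rewrite !mxE /= (leq_trans (ltn_ord i)) // andbT.
  by rewrite -(inj_eq val_inj) /=; case: eqP; rewrite ?mulr1n ?mulr0n.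
rewrite det_diag; under eq_bigr => i _ do rewrite mxE.
rewrite prod_fps_Xn sumn_take_nth // => /fps_dvd_Xn.
by rewrite ltnn.
Qed.

(** The order of the ideal of r-minors is the sum of the first r elementary
    divisors, so these orders determine the Smith normal form. *)
Lemma smith_minorsP m n (e : seq nat) (A : 'M[R]_(m, n)) :
    sorted leq e -> size e = m -> (m <= n)%N ->
  mx_equiv A (smith_mx k m n e) <->
  forall r : 'I_m.+1, minors_dvd r (sumn (take r e)) A /\
                      ~ minors_dvd r (sumn (take r e)).+1 A.
Proof.
move=> sorted_e size_e le_mn; split=> [Ae r|min_e].
  have le_rm : (r <= m)%N by rewrite -ltnS.
  split; first by apply: (minors_dvd_equiv Ae); exact: minors_dvd_smith.
  move/(minors_dvd_equiv (mx_equiv_sym Ae)).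
  by apply: minors_smith_attained; rewrite ?size_e ?(leq_trans le_rm).
have [a [sorted_a size_a Aa]] := smith_normal_form A.
have size_am : size a = m.
  apply/eqP; rewrite eqn_leq (leq_trans size_a) ?geq_minl //= leqNgt.
  apply/negP => lt_am; have [_ []] := min_e ord_max.
  by apply: (minors_dvd_equiv Aa); apply: minors_dvd_smith_big.
have eq_take r : (r <= m)%N -> sumn (take r a) = sumn (take r e).
  move=> le_rm; have [min1 min2] := min_e (Ordinal (le_rm : (r < m.+1)%N)).
  apply/eqP; rewrite eqn_leq; apply/andP; split; rewrite leqNgt; apply/negP => lt_r.
    apply: min2; apply: (minors_dvd_equiv Aa).
    by apply: (minors_dvdW lt_r); apply: minors_dvd_smith.
  have /= := minors_dvd_equiv (mx_equiv_sym Aa) min1.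
  move/(minors_dvdW lt_r); apply: minors_smith_attained; rewrite ?size_am //.
  exact: leq_trans le_mn.
suff -> : e = a by [].
apply: (@eq_from_nth _ 0%N) => [|i]; rewrite size_e ?size_am // => lt_im.
have := eq_take i.+1 lt_im; rewrite !(take_nth 0%N) ?size_am ?size_e //.
by rewrite !sumn_rcons (eq_take _ (ltnW lt_im)) => /addnI.
Qed.

End Minors.

(** * Matrices with prescribed elementary divisors *)

Section ColumnSelection.
Variables (S : comNzRingType) (m N : nat) (g : 'I_m -> 'I_N).
Implicit Types (A : 'M[S]_(m, N)) (v z : 'cV[S]_m) (c : S).

Lemma colsubM p (A : 'M[S]_(m, p)) (B : 'M_(p, N)) :
  colsub g (A *m B) = A *m colsub g B.
Proof.
by apply/matrixP => i j; rewrite !mxE; apply: eq_bigr => l _; rewrite !mxE.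
Qed.

Lemma adj_columns A v :
  \adj (colsub g A) *m (colsub g A *m v) = \det (colsub g A) *: v.
Proof. by rewrite mulmxA mul_adj_mx mul_scalar_mx. Qed.

Lemma adj_columns_add A c v x z i :
  (\adj (colsub g A) *m (v + c *: (A *m (x + colsub g 1%:M *m z)))) i 0 =
  (\adj (colsub g A) *m (v + c *: (A *m x))) i 0 + \det (colsub g A) * (c * z i 0).
Proof.
rewrite (mulmxDr A) scalerDr addrA (mulmxDr (\adj _)) mxE; congr (_ + _).
by rewrite (mulmxA A) -colsubM mulmx1 (scalemxAr c) adj_columns !mxE.
Qed.

End ColumnSelection.

Section FullRankType.
Variable k : fieldType.
Local Notation R := {fps k}.
Local Notation t := (fps_Xn k 1).

Lemma mx_at0_invertible n (V : 'M[R]_n) :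
  \det (map_mx (@fps_at0 k) V) != 0 <-> mx_invertible V.
Proof.
rewrite det_map_mx; split=> [|/mx_invertible_det[c Vc]].
  by move/fps_unit => ?; apply/mx_invertible_det.
apply/eqP => V0; have /eqP := congr1 (@fps_at0 k) Vc.
by rewrite rmorphM rmorph1 V0 mul0r eq_sym oner_eq0.
Qed.

Lemma map_at0_t m n (X : 'M[R]_(m, n)) : map_mx (@fps_at0 k) (t *: X) = 0.
Proof.
by apply/matrixP => i j; rewrite !mxE /fps_at0 coef_fpsXnM.
Qed.

Lemma fps_Xn_scaleI s m n : injective (fun A : 'M[R]_(m, n) => fps_Xn k s *: A).
Proof.
move=> A B /matrixP eqAB; apply/matrixP => i j.
by have := eqAB i j; rewrite !mxE => /fps_XnI.
Qed.

Lemma mx_invertible_1t n (X : 'M[R]_n) : mx_invertible (1%:M + t *: X).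
Proof.
apply/mx_at0_invertible; rewrite map_mxD map_at0_t addr0 map_mx1 det1.
exact: oner_neq0.
Qed.

Lemma nth_le_last (e : seq nat) i : sorted leq e -> (nth 0 e i <= last 0 e)%N.
Proof.
move=> sorted_e; have [lt_i|le_i] := ltnP i (size e); last by rewrite nth_default.
rewrite -nth_last; apply: (sorted_leq_nth leq_trans leqnn) => //.
  by rewrite inE prednK // (leq_ltn_trans _ lt_i).
by rewrite -ltnS prednK // (leq_ltn_trans _ lt_i).
Qed.

Variables (m N : nat) (e : seq nat).
Hypotheses (sorted_e : sorted leq e) (size_e : size e = m) (le_mN : (m <= N)%N).
Local Notation em := (last 0 e)%N.
Local Notation has_type A := (mx_equiv A (smith_mx k m N e)).

(** The square factor B carries the elementary divisors, and W is a split
    surjection. *)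
Lemma type_factor (A : 'M[R]_(m, N)) : has_type A ->
  exists (B : 'M_m) (W : 'M_(m, N)), [/\ A = B *m W, exists W', W *m W' = 1%:M,
    exists B', B *m B' = (fps_Xn k em)%:M &
    exists2 u, fps_at0 u != 0 & \det B = fps_Xn k (sumn e) * u].
Proof.
move=> [U [V [iU [V' VV'] ->]]]; pose d : 'rV[R]_m := \row_i fps_Xn k (nth 0%N e i).
have -> : smith_mx k m N e = diag_mx d *m pid_mx m.
  apply/matrixP => i j; rewrite mul_diag_mx !mxE size_e ltn_ord andbT.
  by case: eqP; rewrite ?mulr1 ?mulr0.
exists (U *m diag_mx d), (pid_mx m *m V); split.
- by rewrite !mulmxA.
- exists (V' *m pid_mx m); rewrite -mulmxA (mulmxA V) VV' mul1mx mul_pid_mx minnn.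
  by rewrite (minn_idPr le_mN) pid_mx_1.
- have [U' UU'] := iU.
  exists (diag_mx (\row_i fps_Xn k (em - nth 0%N e i)) *m U').
  rewrite -mulmxA (mulmxA (diag_mx d)) mulmx_diag.
  have -> : \row_j (d 0 j * (\row_i fps_Xn k (em - nth 0%N e i)) 0 j) =
            const_mx (fps_Xn k em).
    apply/rowP => j; rewrite !mxE -fps_XnD subnKC //.
    exact: nth_le_last.
  by rewrite diag_const_mx mul_scalar_mx -scalemxAr UU' scalemx1.
have /mx_invertible_det[c Uc] := iU; exists (\det U).
  apply/eqP => U0; have /eqP := congr1 (@fps_at0 k) Uc.
  by rewrite rmorphM rmorph1 /= U0 mul0r eq_sym oner_eq0.
rewrite det_mulmx det_diag mulrC; congr (_ * _).
under eq_bigr => i _ do rewrite mxE.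
by rewrite prod_fps_Xn -sumn_take_nth ?size_e // take_oversize ?size_e.
Qed.

Lemma type_right_inverse (A : 'M[R]_(m, N)) : has_type A ->
  exists K, A *m K = (fps_Xn k em)%:M.
Proof.
move=> /type_factor[B [W [-> [W' WW'] [B' BB'] _]]]; exists (W' *m B').
by rewrite -mulmxA (mulmxA W) WW' mul1mx.
Qed.

Lemma has_typeMr (A : 'M[R]_(m, N)) V : mx_invertible V ->
  has_type A -> has_type (A *m V).
Proof.
move=> iV Ae; apply: mx_equiv_trans Ae.
by exists 1%:M, V; split; [exact: mx_invertible1 | | rewrite mul1mx].
Qed.

(** Since t^em annihilates the cokernel of A, a perturbation of A by t^s with
    s > em is absorbed by a change of basis congruent to the identity. *)
Lemma type_perturb (A : 'M[R]_(m, N)) s (M : 'M_(m, N)) : has_type A -> (em < s)%N ->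
  exists X, A + fps_Xn k s *: M = A *m (1%:M + t *: X).
Proof.
move=> /type_right_inverse[K AK] lt_s.
exists (fps_Xn k (s - em.+1) *: (K *m M)).
rewrite mulmxDr mulmx1 scalerA -fps_XnD -scalemxAr mulmxA AK mul_scalar_mx scalerA.
by rewrite -fps_XnD; congr (_ + fps_Xn k _ *: _); rewrite add1n -subSn // subSS subnK // ltnW.
Qed.

Lemma has_type_perturb (A : 'M[R]_(m, N)) s (M : 'M_(m, N)) : (em < s)%N ->
  has_type A -> has_type (A + fps_Xn k s *: M).
Proof.
move=> lt_s Ae; have [X ->] := type_perturb M Ae lt_s.
by apply: has_typeMr => //; exact: mx_invertible_1t.
Qed.

Section Columns.
Variable g : 'I_m -> 'I_N.

(** All m-minors of a matrix of type e vanish to order at least sumn e, so this is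
    nonzero iff the columns selected by [g] carry a minor of least order. *)
Definition minor_coef (A : 'M[R]_(m, N)) : k := \det (colsub g A) (sumn e).

Lemma minor_coef_factor (B : 'M[R]_m) (W : 'M_(m, N)) u :
  \det B = fps_Xn k (sumn e) * u ->
  \det (colsub g (B *m W)) = fps_Xn k (sumn e) * (u * \det (colsub g W)).
Proof. by move=> detB; rewrite colsubM det_mulmx detB mulrA. Qed.

Lemma minor_coefE (A : 'M[R]_(m, N)) a :
  \det (colsub g A) = fps_Xn k (sumn e) * a -> minor_coef A = fps_at0 a.
Proof. by rewrite /minor_coef => ->; rewrite coef_fpsXnM ltnn subnn. Qed.

Lemma minor_coef_det (A : 'M[R]_(m, N)) : has_type A -> exists u,
  fps_at0 u = minor_coef A /\ \det (colsub g A) = fps_Xn k (sumn e) * u.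
Proof.
move=> /type_factor[B [W [-> _ _ [u _ detB]]]].
exists (u * \det (colsub g W)); rewrite (minor_coefE (minor_coef_factor W detB)).
by rewrite (minor_coef_factor W detB).
Qed.

(** Multiplying on the right by a matrix congruent to 1 modulo t does not change
    the leading term of a minor of least order. *)
Lemma minor_coef_perturb (A : 'M[R]_(m, N)) s (M : 'M_(m, N)) :
  has_type A -> (em < s)%N -> minor_coef (A + fps_Xn k s *: M) = minor_coef A.
Proof.
move=> Ae lt_s; have [X ->] := type_perturb M Ae lt_s.
have [B [W [-> _ _ [u _ detB]]]] := type_factor Ae.
have coefW Y : minor_coef (B *m Y) = fps_at0 u * fps_at0 (\det (colsub g Y)).
  by rewrite (minor_coefE (minor_coef_factor Y detB)) rmorphM.
rewrite -mulmxA [LHS]coefW [RHS]coefW; congr (_ * _).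
rewrite -[LHS]det_map_mx -[RHS]det_map_mx; congr (\det _).
have map_colsub (Y : 'M[R]_(m, N)) : map_mx (@fps_at0 k) (colsub g Y) =
    colsub g (map_mx (@fps_at0 k) Y) by apply/matrixP => i j; rewrite !mxE.
by rewrite !map_colsub mulmxDr mulmx1 -scalemxAr map_mxD map_at0_t addr0.
Qed.

(** With A = B W as in [type_factor], the minor is det(B) det(W_g), so it has least
    order iff W_g is invertible, and then A = A_g W_g^-1 W. *)
Lemma columns_span (A : 'M[R]_(m, N)) : has_type A -> minor_coef A != 0 ->
  exists C, A = colsub g A *m C.
Proof.
move=> /type_factor[B [W [-> _ _ [u u0 detB]]]].
rewrite (minor_coefE (minor_coef_factor _ detB)) rmorphM mulf_eq0 negb_or u0 /= => Wg0.
have [Z WZ] : mx_invertible (colsub g W).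
  by apply/mx_at0_invertible; rewrite det_map_mx.
by exists (Z *m W); rewrite colsubM -mulmxA (mulmxA (colsub g W)) WZ mul1mx.
Qed.

Lemma columns_inj (A : 'M[R]_(m, N)) : has_type A -> minor_coef A != 0 ->
  injective (fun v : 'cV_m => colsub g A *m v).
Proof.
move=> Ae A0 v w /(congr1 (mulmx (\adj (colsub g A)))).
have [u [u0 detA]] := minor_coef_det Ae; rewrite !adj_columns detA -!scalerA.
have [u' uu'] : exists u', u * u' = 1 by apply: fps_unit; rewrite u0.
move/fps_Xn_scaleI/(congr1 ( *:%R u')).
by rewrite !scalerA [u' * u]mulrC uu' !scale1r.
Qed.

Lemma minor_coef_inj (A : 'M[R]_(m, N)) : minor_coef A != 0 -> injective g.
Proof.
move=> A0; apply: contrapT => ninj; case/eqP: A0; rewrite /minor_coef -det_tr.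
have -> : (colsub g A)^T = mxsub g id A^T by apply/matrixP => i j; rewrite !mxE.
by rewrite det_not_inj // coef_fps0.
Qed.

End Columns.

(** In the expansion of det(W W') = 1, some minor of W is a unit. *)
Lemma minor_coef_exists (A : 'M[R]_(m, N)) : has_type A ->
  exists g : {ffun 'I_m -> 'I_N}, minor_coef g A != 0.
Proof.
move=> Ae; have [B [W [defA [W' WW'] _ [u u0 detB]]]] := type_factor Ae.
apply: contrapT => /forallNP no_g.
have : fps_at0 (\det (W'^T *m W^T)) = 1.
  by rewrite -trmx_mul WW' trmx1 det1.
rewrite det_mulmx_rect rmorph_sum big1 => [/eqP|g _]; first by rewrite eq_sym oner_eq0.
have -> : rowsub g W^T = (colsub g W)^T by apply/matrixP => i j; rewrite !mxE.
rewrite rmorphM det_tr; have /negP := no_g g.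
rewrite defA (minor_coefE (minor_coef_factor _ _ detB)) rmorphM mulf_eq0 negb_or u0 /= negbK => /eqP ->.
by rewrite mulr0.
Qed.

End FullRankType.

(** * Taylor expansion and the lifting of approximate solutions *)

Section Taylor.
Variables (k : fieldType) (N : nat).
Local Notation R := {fps k}.
Local Notation evalR x := (mmap (@fps_const k) x).
Implicit Types (x y a : 'I_N -> R) (p q : {mpoly k[N]}).

Definition t_nonexpanding (F : ('I_N -> R) -> R) : Prop :=
  forall s x y, (forall j, fps_dvd s (x j - y j)) -> fps_dvd s (F x - F y).

Lemma t_nonexpandingD F G :
  t_nonexpanding F -> t_nonexpanding G -> t_nonexpanding (fun x => F x + G x).
Proof.
move=> cF cG s x y xy; rewrite opprD addrACA.
by apply: fps_dvdD; [exact: cF | exact: cG].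
Qed.

Lemma t_nonexpandingM F G :
  t_nonexpanding F -> t_nonexpanding G -> t_nonexpanding (fun x => F x * G x).
Proof.
move=> cF cG s x y xy.
have -> : F x * G x - F y * G y = G x * (F x - F y) + F y * (G x - G y).
  by rewrite !mulrBr [G x * F x]mulrC [G x * F y]mulrC addrA subrK.
by apply: fps_dvdD; apply: fps_dvdMl; [exact: cF | exact: cG].
Qed.

Lemma t_nonexpanding_cst c : t_nonexpanding (fun=> c).
Proof. by move=> s x y _; rewrite subrr; exact: fps_dvd0. Qed.

Lemma t_nonexpanding_sum (F : 'I_N -> ('I_N -> R) -> R) :
  (forall j, t_nonexpanding (F j)) -> t_nonexpanding (fun x => \sum_j F j x).
Proof.
by move=> cF s x y xy; rewrite -sumrB; apply: fps_dvd_sum => j _; exact: cF.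
Qed.

Lemma t_nonexpanding_coord j : t_nonexpanding (fun x => x j).
Proof. by move=> s x y; apply. Qed.

Definition differential a p x : R := \sum_j evalR a (mderiv j p) * x j.

Lemma t_nonexpanding_differential a p : t_nonexpanding (differential a p).
Proof.
apply: t_nonexpanding_sum => j; apply: t_nonexpandingM; first exact: t_nonexpanding_cst.
exact: t_nonexpanding_coord.
Qed.

(** The remainder is a polynomial in x; all that the Newton iteration needs from
    it is that it does not expand t-adic distances. *)
Definition has_taylor a h p : Prop :=
  exists2 Q, t_nonexpanding Q & forall x, evalR (fun j => a j + h * x j) p =
    evalR a p + h * differential a p x + h * h * Q x.

Lemma has_taylorC a h c : has_taylor a h c%:MP.
Proof.
exists (fun=> 0); first exact: t_nonexpanding_cst.
move=> x; rewrite !mmapC mulr0 addr0 /differential big1 ?mulr0 ?addr0 // => j _.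
by rewrite mderivC rmorph0 mul0r.
Qed.

Lemma has_taylorX a h i : has_taylor a h 'X_i.
Proof.
exists (fun=> 0); first exact: t_nonexpanding_cst.
move=> x; rewrite !mmapX !mmap1U mulr0 addr0 /differential; congr (_ + h * _).
rewrite (bigD1 i) //= mderivX mnm1E eqxx scale1r -{1}[U_(i)%MM]add0m addmK mpolyX0 rmorph1 mul1r.
rewrite big1 ?addr0 // => j /negPf ne_ji.
by rewrite mderivX mnm1E eq_sym ne_ji scale0r rmorph0 mul0r.
Qed.

Lemma has_taylorD a h p q : has_taylor a h p -> has_taylor a h q -> has_taylor a h (p + q).
Proof.
move=> [Q cQ pE] [Q' cQ' qE]; exists (fun x => Q x + Q' x); first exact: t_nonexpandingD.
move=> x; rewrite !rmorphD /= pE qE.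
have -> : differential a (p + q) x = differential a p x + differential a q x.
  rewrite -big_split; apply: eq_bigr => j _.
  by rewrite mderivD rmorphD mulrDl.
by rewrite !mulrDr addrACA [X in X + _ = _]addrACA.
Qed.

Lemma has_taylorM a h p q : has_taylor a h p -> has_taylor a h q -> has_taylor a h (p * q).
Proof.
move=> [Q cQ pE] [Q' cQ' qE].
pose D := differential a p; pose D' := differential a q.
have [cD cD'] : t_nonexpanding D /\ t_nonexpanding D'.
  by split; exact: t_nonexpanding_differential.
exists (fun x => evalR a p * Q' x + evalR a q * Q x + D x * D' x
  + h * (D x * Q' x + D' x * Q x) + h * h * (Q x * Q' x)).
  by do ?[apply: t_nonexpandingD | apply: t_nonexpandingM | exact: t_nonexpanding_cst].
move=> x; rewrite !rmorphM /= pE qE.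
have -> : differential a (p * q) x = evalR a q * D x + evalR a p * D' x.
  rewrite /D /D' /differential !mulr_sumr -big_split; apply: eq_bigr => j _.
  by rewrite mderivM rmorphD !rmorphM /= mulrDl !mulrA [evalR a q * _]mulrC.
rewrite -/(D x) -/(D' x).
move: (evalR a p) (evalR a q) (D x) (D' x) (Q x) (Q' x) => *.
by ring.
Qed.

Lemma taylor a h p : has_taylor a h p.
Proof.
have monomial_taylor (m : 'X_{1..N}) : has_taylor a h 'X_[m].
  rewrite mpolyXE_id; elim/big_rec: _ => [|i q _ IHq].
    by rewrite -mpolyC1; exact: has_taylorC.
  apply: has_taylorM IHq; elim: (m i) => [|d IHd].
    by rewrite expr0 -mpolyC1; exact: has_taylorC.
  by rewrite exprS; apply: has_taylorM IHd; exact: has_taylorX.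
elim/mpolyind: p => [|c m p _ _ IHp]; first by rewrite -mpolyC0; exact: has_taylorC.
apply: has_taylorD IHp; rewrite -mul_mpolyC.
by apply: has_taylorM (monomial_taylor m); exact: has_taylorC.
Qed.

End Taylor.

Section System.
Variables (k : fieldType) (N m : nat) (f : 'I_m -> {mpoly k[N]}).
Local Notation R := {fps k}.
Implicit Types (a : arc_space k N) (s r : nat) (x y : 'cV[R]_N).

Definition arc_add a s x : arc_space k N := [ffun j => a j + fps_Xn k s * x j 0].

Definition equations a : 'cV[R]_m := \col_i mmap (@fps_const k) a (f i).

Definition jacobian a : 'M[R]_(m, N) :=
  \matrix_(i, j) mmap (@fps_const k) a (mderiv j (f i)).

Lemma mmap_arc_add a s x p : mmap (@fps_const k) (arc_add a s x) p =
  mmap (@fps_const k) (fun j => a j + fps_Xn k s * x j 0) p.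
Proof. by congr mmap; apply: funext => j; rewrite ffunE. Qed.

Lemma equations_taylor a s : exists2 Q : 'cV_N -> 'cV_m,
  forall r x y, (forall j, fps_dvd r (x j 0 - y j 0)) ->
    forall i, fps_dvd r (Q x i 0 - Q y i 0) &
  forall x, equations (arc_add a s x) =
    equations a + fps_Xn k s *: (jacobian a *m x) + fps_Xn k (s + s) *: Q x.
Proof.
have /choice[Q QP] : forall i, exists Q : ('I_N -> R) -> R, t_nonexpanding Q /\
    forall x : 'I_N -> R,
      mmap (@fps_const k) (fun j => a j + fps_Xn k s * x j) (f i) =
      mmap (@fps_const k) a (f i) + fps_Xn k s * differential a (f i) x
      + fps_Xn k s * fps_Xn k s * Q x.
  by move=> i; have [Q cQ QE] := taylor a (fps_Xn k s) (f i); exists Q.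
exists (fun x => \col_i Q i (fun j => x j 0)) => [r x y xy i|x].
  by rewrite !mxE; have [cQ _] := QP i; exact: cQ.
apply/colP => i; rewrite !mxE mmap_arc_add; have [_ QE] := QP i.
rewrite (QE (fun j => x j 0)) fps_XnD; congr (_ + _ * _ + _).
by apply: eq_bigr => j _; rewrite mxE.
Qed.

Lemma jacobian_taylor a s x :
  exists M, jacobian (arc_add a s x) = jacobian a + fps_Xn k s *: M.
Proof.
have /choice[M ME] : forall ij : 'I_m * 'I_N, exists c,
    mmap (@fps_const k) (arc_add a s x) (mderiv ij.2 (f ij.1)) =
    mmap (@fps_const k) a (mderiv ij.2 (f ij.1)) + fps_Xn k s * c.
  move=> [i j] /=; have [Q _ QE] := taylor a (fps_Xn k s) (mderiv j (f i)).
  rewrite mmap_arc_add (QE (fun j => x j 0)).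
  by rewrite -addrA -mulrA -mulrDr; eexists.
exists (\matrix_(i, j) M (i, j)); apply/matrixP => i j; rewrite !mxE.
exact: (ME (i, j)).
Qed.

Variable e : seq nat.
Hypotheses (sorted_e : sorted leq e) (size_e : size e = m) (le_mN : (m <= N)%N).
Local Notation em := (last 0 e)%N.
Local Notation has_type A := (mx_equiv A (smith_mx k m N e)).

Lemma has_type_arc_add a s x : (em < s)%N ->
  has_type (jacobian a) -> has_type (jacobian (arc_add a s x)).
Proof.
move=> lt_s; have [M ->] := jacobian_taylor a s x.
exact: has_type_perturb.
Qed.

(** The condition for the linearised equation f(a) + t^s J(a) x = 0 to have a
    solution x. *)
Definition liftable s a : Prop :=
  exists w, equations a = fps_Xn k s *: (jacobian a *m w).

(** Newton's method. If f(a) = t^s J w, the correction eta solves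
    eta = - w - t^(s-em) K Q(eta), where J K = t^em and t^(2s) Q is the Taylor
    remainder; the right-hand side is a contraction in eta because s > em. *)
Lemma hensel a s : (em < s)%N -> has_type (jacobian a) -> liftable s a ->
  exists x, equations (arc_add a s x) = 0.
Proof.
move=> lt_s type_a [w aE]; have [K JK] := type_right_inverse sorted_e size_e le_mN type_a.
have [Q cQ QE] := equations_taylor a s.
pose c := fps_Xn k (s - em).
pose G (x : 'I_N -> R) j := (- w - c *: (K *m Q (\col_j x j))) j 0.
have [|x fix_x] := @fps_contraction_fixpoint k _ G.
  move=> r x y xy j; apply/fps_eqmodP; rewrite /G.
  have -> : forall u v : 'cV[R]_N, (- w - u) j 0 - (- w - v) j 0 = (v - u) j 0.
    by move=> u v; rewrite !mxE; ring.
  rewrite -scalerBr -mulmxBr !mxE mulr_sumr; apply: fps_dvd_sum => i _.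
  rewrite mulrCA; apply: fps_dvdMl.
  have [|d dE] := cQ r (\col_j y j) (\col_j x j) _ i.
    move=> j'; rewrite !mxE; apply/fps_eqmodP => n lt_n.
    by rewrite xy.
  move: dE; rewrite !mxE => ->; apply: (@fps_dvdW _ (s - em + r)).
    by rewrite -add1n leq_add2r subn_gt0.
  by exists d; rewrite fps_XnD mulrA.
pose y : 'cV[R]_N := \col_j x j; exists y; rewrite QE aE; set q := Q y.
have {1}-> : y = - w - c *: (K *m q).
  by apply/colP => j; rewrite [LHS]mxE -[LHS]fix_x /G.
rewrite [fps_Xn k (s + s)]fps_XnD.
have cE : c * fps_Xn k em = fps_Xn k s by rewrite -fps_XnD subnK // ltnW.
rewrite mulmxDr !mulmxN -scalemxAr mulmxA JK mul_scalar_mx scalerA cE.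
rewrite -scalerA -!scalerDr.
by rewrite addrA subrr add0r addNr scaler0.
Qed.

(** The Jacobians at a and at a + t^s x have the same image, which contains
    t^em R^m and so absorbs the Taylor remainder. *)
Lemma liftable_arc_add a s x : (em < s)%N -> has_type (jacobian a) ->
  liftable s (arc_add a s x) -> liftable s a.
Proof.
move=> lt_s type_a [w]; have [K JK] := type_right_inverse sorted_e size_e le_mN type_a.
have [M ->] := jacobian_taylor a s x.
have [X ->] := type_perturb sorted_e size_e le_mN M type_a lt_s.
have [Q _ ->] := equations_taylor a s => eq_w.
exists ((1%:M + fps_Xn k 1 *: X) *m w - x - fps_Xn k (s - em) *: (K *m Q x)).
have cE : fps_Xn k (s - em) * fps_Xn k em = fps_Xn k s.
  by rewrite -fps_XnD subnK // ltnW.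
rewrite !mulmxBr mulmxA -scalemxAr mulmxA JK mul_scalar_mx scalerA cE.
by rewrite !scalerBr -eq_w scalerA -fps_XnD addrAC addrK addrK.
Qed.

Section Columns.
Variable g : 'I_m -> 'I_N.
Local Notation columns a := (colsub g (jacobian a)).

(** The images of A and A_g agree, and adj(A_g) takes A_g y to det(A_g) y, where
    det(A_g) is a unit times t^E with E = sumn e; conversely a vector v is
    recovered from adj(A_g) v by applying A_g and dividing by det(A_g). *)
Lemma column_space_minors (A : 'M[R]_(m, N)) s (v : 'cV_m) :
    has_type A -> minor_coef e g A != 0 ->
  (exists w, v = fps_Xn k s *: (A *m w)) <->
  forall i, fps_dvd (sumn e + s) ((\adj (colsub g A) *m v) i 0).
Proof.
move=> type_A A0; have [u [u0 detA]] := minor_coef_det sorted_e size_e le_mN g type_A.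
have [C defA] := columns_span sorted_e size_e le_mN type_A A0.
split=> [[w ->] i|dvd_v].
  have -> : A *m w = colsub g A *m (C *m w) by rewrite mulmxA -defA.
  rewrite scalemxAr adj_columns detA -scalerA; set y := C *m w.
  exists (u * y i 0); rewrite [LHS]mxE fps_XnD -mulrA; congr (_ * _).
  by rewrite [LHS]mxE mulrCA; congr (_ * _); rewrite mxE.
have [u' uu'] : exists u', u * u' = 1 by apply: fps_unit; rewrite u0.
have /choice[z zE] := dvd_v.
exists (colsub g 1%:M *m \col_i (u' * z i)).
rewrite mulmxA -colsubM mulmx1.
have adjE : \adj (colsub g A) *m v = fps_Xn k (sumn e) *: (fps_Xn k s *: \col_i z i).
  by apply/colP => i; rewrite zE !mxE mulrA fps_XnD.
have := congr1 (mulmx (colsub g A)) adjE.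
rewrite mulmxA mul_mx_adj detA mul_scalar_mx -!scalemxAr -scalerA => eq_v.
have -> : \col_i (u' * z i) = u' *: \col_i z i by apply/colP => i; rewrite !mxE.
rewrite -scalemxAr.
have /(congr1 ( *:%R u')) := fps_Xn_scaleI eq_v.
by rewrite scalerA [u' * u]mulrC uu' scale1r scalerA mulrC -scalerA.
Qed.

(** The obstruction to one more step: with f(a) = t^s J w and J = J_g C, the arc
    a + t^s x is liftable at order s + 1 iff C (w + x) vanishes at t = 0. The
    adjugate of J_g extracts this vector without dividing. *)
Lemma liftable_step a s x : (em < s)%N -> has_type (jacobian a) ->
    minor_coef e g (jacobian a) != 0 -> liftable s a ->
  liftable s.+1 (arc_add a s x) <->
  forall i, (\adj (columns a) *m (equations a + fps_Xn k s *: (jacobian a *m x)))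
              i 0 (sumn e + s)%N = 0.
Proof.
move=> lt_s type_a a0 [w aE]; have [K JK] := type_right_inverse sorted_e size_e le_mN type_a.
have [u [u0 det_a]] := minor_coef_det sorted_e size_e le_mN g type_a.
have [C JE] := columns_span sorted_e size_e le_mN type_a a0.
have columns_inj_a := columns_inj sorted_e size_e le_mN type_a a0.
have [Q _ QE] := equations_taylor a s.
have [M J'E] := jacobian_taylor a s x.
have [X J'E2] := type_perturb sorted_e size_e le_mN M type_a lt_s.
set J' := jacobian (arc_add a s x); have J'JX : J' = jacobian a *m (1%:M + fps_Xn k 1 *: X).
  by rewrite /J' J'E J'E2.
pose y := C *m (w + x); pose q := C *m K *m Q x.
have lin : equations a + fps_Xn k s *: (jacobian a *m x) =
    columns a *m (fps_Xn k s *: y).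
  by rewrite aE -scalerDr -mulmxDr {1}JE -mulmxA -scalemxAr.
have val : equations (arc_add a s x) =
    columns a *m (fps_Xn k s *: (y + fps_Xn k (s - em) *: q)).
  rewrite QE lin scalerDr mulmxDr; congr (_ + _).
  rewrite -!scalemxAr /q !mulmxA -JE JK mul_scalar_mx !scalerA.
  by rewrite -mulrA -!fps_XnD subnK // ltnW.
have coefE i : (\adj (columns a) *m (equations a + fps_Xn k s *: (jacobian a *m x)))
    i 0 (sumn e + s)%N = fps_at0 u * fps_at0 (y i 0).
  rewrite lin adj_columns det_a scalerA mulrAC -fps_XnD mxE -mulrA.
  by rewrite coef_fpsXnM ltnn subnn -/(fps_at0 (u * y i 0)) rmorphM.
have sE : fps_Xn k s.+1 = fps_Xn k s * fps_Xn k 1 by rewrite -addn1 fps_XnD.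
have u_neq0 : fps_at0 u != 0 by rewrite u0.
have dvd_q : forall i, fps_dvd 1 ((fps_Xn k (s - em) *: q) i 0).
  move=> i; rewrite mxE; apply: (@fps_dvdW _ (s - em)); first by rewrite subn_gt0.
  by eexists.
split=> [[w' w'E] i|y0].
  rewrite coefE; suff /fps_dvd1-> : fps_dvd 1 (y i 0) by rewrite mulr0.
  set z := C *m ((1%:M + fps_Xn k 1 *: X) *m w').
  have z_y : fps_Xn k 1 *: z = y + fps_Xn k (s - em) *: q.
    apply: (@fps_Xn_scaleI _ s); apply: columns_inj_a; rewrite -val w'E -/J' J'JX.
    rewrite scalerA -sE -scalemxAr; congr (_ *: _).
    by rewrite /z (mulmxA (columns a)) -JE mulmxA.
  have -> : y i 0 = fps_Xn k 1 * z i 0 - (fps_Xn k (s - em) *: q) i 0.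
    have /colP/(_ i) := z_y; rewrite [LHS]mxE [RHS]mxE => ->.
    by rewrite addrK.
  apply: fps_dvdD; first by exists (z i 0).
  by rewrite -mulN1r; exact: fps_dvdMl.
have [X' XX'] : mx_invertible (1%:M + fps_Xn k 1 *: X) by exact: mx_invertible_1t.
have /choice[z zE] : forall i, exists z, y i 0 + (fps_Xn k (s - em) *: q) i 0 = fps_Xn k 1 * z.
  move=> i; apply: fps_dvdD => //; apply/fps_dvd1; have := y0 i.
  by rewrite coefE => /eqP; rewrite mulf_eq0 (negPf u_neq0) => /eqP.
exists (X' *m (colsub g 1%:M *m \col_i z i)); rewrite -/J' J'JX val.
rewrite (mulmxA _ X') -(mulmxA (jacobian a)) XX' mulmx1 mulmxA -colsubM mulmx1.
rewrite (scalemxAr _ (columns a)) sE -scalerA; congr (_ *m (_ *: _)); apply/colP => i.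
by rewrite mxE zE !mxE.
Qed.

End Columns.
End System.

(** * Modules over k[[t]] and elementary divisors *)

Section Presentations.
Variable R : pzRingType.

Lemma lmod_iso_sym (U V : lmodType R) : lmod_iso U V -> lmod_iso V U.
Proof.
move=> [phi [psi phiK psiK]].
have lin_psi : linear psi.
  by move=> a u v; apply: (can_inj phiK); rewrite linearP !psiK.
pose psiL : {linear V -> U} := HB.pack psi (GRing.isLinear.Build R V U *:%R psi lin_psi).
by exists psiL; exists phi.
Qed.

Lemma lmod_iso_trans (U V W : lmodType R) : lmod_iso U V -> lmod_iso V W -> lmod_iso U W.
Proof.
move=> [phi bij_phi] [psi bij_psi]; exists (psi \o phi : {linear U -> W}).
exact: bij_comp.
Qed.

(** The isomorphism sends p x to q x. It avoids constructing a map out of a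
    quotient on representatives. *)
Lemma lmod_iso_of_ker (F U V : lmodType R) (p : F -> U) (q : F -> V) :
    linear p -> linear q -> (forall u, exists x, p x = u) ->
    (forall v, exists x, q x = v) -> (forall x, p x = 0 <-> q x = 0) ->
  lmod_iso U V.
Proof.
move=> lin_p lin_q surj_p surj_q ker_pq.
pose P : {linear F -> U} := HB.pack p (GRing.isLinear.Build R F U *:%R p lin_p).
pose Q : {linear F -> V} := HB.pack q (GRing.isLinear.Build R F V *:%R q lin_q).
have eq_pq x y : P x = P y <-> Q x = Q y.
  have ker_xy : P (x - y) = 0 <-> Q (x - y) = 0 := ker_pq (x - y).
  rewrite !raddfB in ker_xy.
  by split=> /eqP; rewrite -subr_eq0 => /eqP/ker_xy/eqP; rewrite subr_eq0 => /eqP.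
have /choice[s sK] := surj_p; have /choice[s' s'K] := surj_q.
pose phi u := Q (s u).
have phiP x : phi (P x) = Q x by apply/eq_pq; exact: sK.
have lin_phi : linear phi.
  move=> a u v; rewrite -[u]sK -[v]sK -[p (s u)]/(P (s u)) -[p (s v)]/(P (s v)).
  by rewrite -linearP !phiP; exact: linearP.
pose phiL : {linear U -> V} := HB.pack phi (GRing.isLinear.Build R U V *:%R phi lin_phi).
exists phiL; exists (fun v => P (s' v)) => [u|v] /=.
  by rewrite -[RHS]sK; apply/eq_pq; exact: s'K.
by rewrite phiP; exact: s'K.
Qed.

End Presentations.

Section Layers.
Variable k : fieldType.
Local Notation R := {fps k}.
Implicit Types (M : lmodType R) (j d : nat).

(** The k-vector space t^j M / t^(j+1) M has dimension d: the v_i, which lie in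
    t^j M, induce a basis of it. *)
Definition layer_dim M j d : Prop :=
  exists v : 'I_d -> M, [/\ forall i, exists x, v i = fps_Xn k j *: x,
    forall x, exists (c : 'I_d -> k) y,
      fps_Xn k j *: x = \sum_i fps_const (c i) *: v i + fps_Xn k j.+1 *: y &
    forall (c : 'I_d -> k) y,
      \sum_i fps_const (c i) *: v i = fps_Xn k j.+1 *: y -> forall i, c i = 0].

Lemma layer_dim_iso M M' j d : lmod_iso M M' -> layer_dim M j d -> layer_dim M' j d.
Proof.
move=> [phi [psi phiK psiK]] [v [v_layer v_gen v_free]]; exists (phi \o v); split.
- by move=> i; have [x vE] := v_layer i; exists (phi x); rewrite /= vE linearZ.
- move=> x; have [c [y xE]] := v_gen (psi x); exists c, (phi y).
  rewrite -[x]psiK -linearZ /= xE linearD linearZ linear_sum /=; congr (_ + _).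
  by apply: eq_bigr => i _; rewrite linearZ.
move=> c y eq_y; apply: (v_free c (psi y)); apply: (can_inj phiK).
rewrite linearZ /= psiK -eq_y linear_sum; apply: eq_bigr => i _.
by rewrite linearZ.
Qed.

(** The coordinates of d' vectors on d < d' generators satisfy a linear relation. *)
Lemma layer_dim_leq M j d d' : layer_dim M j d -> layer_dim M j d' -> (d' <= d)%N.
Proof.
move=> [v [_ v_gen _]] [w [w_layer _ w_free]]; rewrite leqNgt; apply/negP => lt_d.
have /choice[c /choice[y wE]] : forall i, exists (c : 'I_d -> k) y,
    w i = \sum_l fps_const (c l) *: v l + fps_Xn k j.+1 *: y.
  by move=> i; have [x ->] := w_layer i; exact: v_gen.
pose A : 'M[k]_(d', d) := \matrix_(i, l) c i l.
have /rowV0Pn[u /sub_kermxP uA u_neq0] : kermx A != 0.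
  by rewrite kermx_eq0 -row_leq_rank -ltnNge (leq_ltn_trans (rank_leq_col A)).
case/eqP: u_neq0; apply/rowP => i; rewrite mxE.
apply: (w_free (u 0) (\sum_i fps_const (u 0 i) *: y i)).
rewrite scaler_sumr.
under eq_bigr => i' _ do rewrite wE scalerDr scaler_sumr.
rewrite big_split /= exchange_big big1 ?add0r => [|l _].
  by apply: eq_bigr => i' _; rewrite !scalerA mulrC.
under eq_bigr => i' _ do rewrite scalerA -rmorphM.
rewrite -scaler_suml -rmorph_sum; have /rowP/(_ l) := uA; rewrite !mxE.
under eq_bigr => i' _ do rewrite mxE.
by move=> ->; rewrite rmorph0 scale0r.
Qed.

Lemma layer_dim_uniq M j d d' : layer_dim M j d -> layer_dim M j d' -> d = d'.
Proof.
move=> h h'; apply/eqP; rewrite eqn_leq.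
by rewrite (layer_dim_leq h h') (layer_dim_leq h' h).
Qed.

Lemma layer_dim_prod M M' j d d' :
  layer_dim M j d -> layer_dim M' j d' -> layer_dim (M * M')%type j (d + d').
Proof.
move=> [v [v_layer v_gen v_free]] [v' [v'_layer v'_gen v'_free]].
pose w (i : 'I_(d + d')) : M * M' :=
  match split i with inl i1 => (v i1, 0) | inr i2 => (0, v' i2) end.
have sumE (c : 'I_(d + d') -> k) : \sum_i fps_const (c i) *: w i =
    (\sum_i fps_const (c (lshift d' i)) *: v i,
     \sum_i fps_const (c (rshift d i)) *: v' i).
  rewrite big_split_ord /= /w; under eq_bigr => i _ do rewrite (unsplitK (inl i)).
  under [X in _ + X]eq_bigr => i _ do rewrite (unsplitK (inr i)).
  rewrite [LHS]surjective_pairing /= !raddf_sum /=.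
  by congr pair; [rewrite [X in _ + X]big1 ?addr0 // | rewrite [X in X + _]big1 ?add0r //];
    move=> i _; rewrite scaler0.
exists w; split.
- move=> i; rewrite /w; case: split => l.
    by have [x ->] := v_layer l; exists (x, 0); congr pair; rewrite /= scaler0.
  by have [x ->] := v'_layer l; exists (0, x); congr pair; rewrite /= scaler0.
- move=> [x x']; have [c [y xE]] := v_gen x; have [c' [y' x'E]] := v'_gen x'.
  exists (fun i => match split i with inl i1 => c i1 | inr i2 => c' i2 end), (y, y').
  rewrite sumE; congr pair => /=.
    by rewrite xE; congr (_ + _); apply: eq_bigr => i _; rewrite (unsplitK (inl i)).
  by rewrite x'E; congr (_ + _); apply: eq_bigr => i _; rewrite (unsplitK (inr i)).
move=> c [y y']; rewrite sumE => -[eq_y eq_y'] i.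
by case: (split_ordP i) => l ->; [exact: v_free eq_y l | exact: v'_free eq_y' l].
Qed.

End Layers.

Section Elementary.
Variable k : fieldType.
Local Notation R := {fps k}.

Lemma quot_proj_eq0 (S : comNzRingType) (V : lmodType S) n (h : 'I_n -> V) v :
  quot_proj h v = 0 <-> exists c : 'I_n -> S, v = \sum_i c i *: h i.
Proof.
have -> : (0 : quot_mod h) = quot_proj h 0.
  by apply: (@addrI _ (quot_proj h 0)); rewrite -quot_projD !addr0.
rewrite eq_quot_proj subr0; split=> [/asboolP //|hv]; exact/asboolP.
Qed.

Lemma quot_proj_linear (S : comNzRingType) (V : lmodType S) n (h : 'I_n -> V) :
  linear (quot_proj h).
Proof. by move=> a u v; rewrite quot_projD quot_projZ. Qed.

Lemma fps_mod_eq0 d (a : R) :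
  quot_proj (fun _ : 'I_1 => fps_Xn k d : R^o) a = 0 <-> fps_dvd d a.
Proof.
rewrite quot_proj_eq0; split=> [[c ->]|[b ->]].
  by rewrite big_ord1; exists (c ord0); rewrite mulrC.
by exists (fun=> b); rewrite big_ord1 [RHS]mulrC.
Qed.

Lemma layer_dim_fps_mod d j : layer_dim (fps_mod k d) j (j < d).
Proof.
pose p (a : R^o) := quot_proj (fun _ : 'I_1 => fps_Xn k d : R^o) a.
have pZ a b : p (a * b) = a *: p b := quot_projZ _ _ _.
have pD a b : p (a + b) = p a + p b := quot_projD _ _ _.
have pK (q : fps_mod k d) : exists a, q = p a by exists (quot_repr q); rewrite [RHS]quot_reprK.
case: ltnP => [lt_jd|le_dj].
  exists (fun=> p (fps_Xn k j)); split.
  - by move=> _; exists (p 1); rewrite -pZ mulr1.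
  - move=> x; have [a ->] := pK x.
    have /fps_dvd1 [b aE] : fps_at0 (a - fps_const (fps_at0 a)) = 0.
      by rewrite rmorphB /= /fps_at0 /= subrr.
    exists (fun=> fps_at0 a), (p b).
    rewrite big_ord1 -!pZ -pD -addn1 fps_XnD -mulrA -aE mulrBr addrC.
    by rewrite [fps_const _ * _]mulrC subrK.
  move=> c x; have [a ->] := pK x; rewrite big_ord1 -!pZ => /eqP.
  rewrite -subr_eq0 -scaleN1r -pZ -pD => /eqP/fps_mod_eq0/fps_dvdP/(_ j lt_jd) cj i.
  move: cj; rewrite coef_fpsD coef_fpsCM mulrCA coef_fpsXnM ltnSn addr0 /= eqxx mulr1.
  by rewrite (ord1 i).
exists (fun=> 0); split=> [[]//|x|c y _ []//].
have [a ->] := pK x; exists (fun=> 0), 0; rewrite big_ord0 scaler0 addr0 -pZ.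
by apply/fps_mod_eq0; apply: (@fps_dvdW _ j) => //; exists a.
Qed.

Lemma layer_dim_free r j : layer_dim {ffun 'I_r -> R^o} j r.
Proof.
exists (fun i => [ffun l => (l == i)%:R * fps_Xn k j]).
have sumE (c : 'I_r -> k) :
    \sum_i fps_const (c i) *: ([ffun l => (l == i)%:R * fps_Xn k j] : {ffun 'I_r -> R^o})
    = [ffun l => fps_const (c l) * fps_Xn k j].
  apply/ffunP => l; rewrite sum_ffunE ffunE (bigD1 l isT) big1 => [|i /negPf ne_il].
    by rewrite [LHS]addr0 2!ffunE eqxx mul1r.
  by rewrite 2!ffunE eq_sym ne_il mul0r scaler0.
split.
- move=> i; exists [ffun l => (l == i)%:R]; apply/ffunP => l; rewrite !ffunE.
  exact: mulrC.
- move=> x; have /choice[b bE] : forall l, exists b,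
      x l - fps_const (fps_at0 (x l)) = fps_Xn k 1 * b.
    by move=> l; apply/fps_dvd1; rewrite rmorphB /= /fps_at0 /= subrr.
  exists (fun l => fps_at0 (x l)), [ffun l => b l]; rewrite sumE.
  apply/ffunP => l; rewrite !ffunE.
  rewrite -[fps_Xn k j.+1 *: _]/(fps_Xn k j.+1 * b l) -[LHS]/(fps_Xn k j * x l).
  by rewrite -addn1 fps_XnD -mulrA -bE mulrBr addrC [fps_const _ * _]mulrC subrK.
move=> c y; rewrite sumE => /ffunP eq_y i.
have eq_yi : fps_const (c i) * fps_Xn k j = fps_Xn k j.+1 * y i.
  by have := eq_y i; rewrite 2!ffunE.
have := congr1 (fun a : R => a j) eq_yi.
by rewrite coef_fpsCM coef_fpsXnM ltnSn /= eqxx mulr1.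
Qed.

Lemma layer_dim_elementary e r j :
  layer_dim (elementary_module k e r) j (count (fun d => j < d)%N e + r).
Proof.
elim: e => [|d e IHe] /=; first exact: layer_dim_free.
by rewrite -addnA; apply: layer_dim_prod IHe; exact: layer_dim_fps_mod.
Qed.

(** The number of summands with exponent > j is read off from the layers of the
    module; summands with exponent 0 vanish, hence the hypothesis on sizes. *)
Lemma elementary_module_inj e e' r r' :
    sorted leq e -> sorted leq e' -> (size e + r = size e' + r')%N ->
    lmod_iso (elementary_module k e r) (elementary_module k e' r') ->
  e = e'.
Proof.
move=> sorted_e sorted_e' eq_size iso.
have eq_layers j : (count (fun d => j < d) e + r = count (fun d => j < d) e' + r')%N.
  apply: layer_dim_uniq (layer_dim_elementary e' r' j).
  exact: layer_dim_iso iso (layer_dim_elementary e r j).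
have count_max s j : (\max_(d <- s) d <= j)%N -> count (fun d => j < d)%N s = 0%N.
  move=> le_j; apply/eqP; rewrite -leqn0 leqNgt -has_count; apply/hasPn => d sd.
  by rewrite -leqNgt (leq_trans _ le_j) // leq_bigmax_seq.
have eq_r : r = r'.
  pose j := maxn (\max_(d <- e) d) (\max_(d <- e') d).
  by have := eq_layers j; rewrite !count_max ?leq_maxl ?leq_maxr.
have eq_sz : size e = size e' by apply/eqP; rewrite -(eqn_add2r r) eq_size eq_r.
have count_gt j : count (fun d => j < d)%N e = count (fun d => j < d)%N e'.
  by apply/eqP; rewrite -(eqn_add2r r) eq_layers eq_r.
apply: (sorted_eq leq_trans anti_leq) => //; apply/allP => d _ /=; apply/eqP.
have count_ge s : count (fun x => d <= x)%N s = (count_mem d s + count (fun x => d < x)%N s)%N.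
  rewrite -count_predUI [X in (_ + X)%N](_ : _ = 0%N) ?addn0.
    by apply: eq_count => x /=; rewrite leq_eqVlt eq_sym.
  by rewrite (eq_count (a2 := pred0)) ?count_pred0 // => x /=; case: eqP => // ->; rewrite ltnn.
have eq_ge : count (fun x => d <= x)%N e = count (fun x => d <= x)%N e'.
  case: d {count_ge} => [|d]; last exact: count_gt.
  by rewrite !(eq_count (a2 := predT)) ?count_predT.
by apply/eqP; rewrite -(eqn_add2r (count (fun x => d < x)%N e)) -count_ge eq_ge count_ge count_gt.
Qed.

(** The canonical surjection onto the sum of cyclic modules. Its source is a module
    of infinite sequences so that the recursion stays inside one type. *)
Fixpoint elementary_proj (e : seq nat) (r : nat) (w : nat -> R) :
    elementary_module k e r :=
  if e is d :: e' return elementary_module k e r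
  then (quot_proj (fun _ : 'I_1 => fps_Xn k d : R^o) (w 0%N),
        elementary_proj e' r (fun i => w i.+1))
  else [ffun i : 'I_r => w i].

Lemma elementary_proj_linear e r a w w' :
  elementary_proj e r (fun i => a * w i + w' i) =
  a *: elementary_proj e r w + elementary_proj e r w'.
Proof.
elim: e w w' => [|d e IHe] w w' /=; first by apply/ffunP => i; rewrite !ffunE.
by rewrite IHe; congr pair; exact: (quot_proj_linear _ a (w 0%N : R^o)).
Qed.

Lemma elementary_proj_eq0 e r w : elementary_proj e r w = 0 <->
  (forall i, (i < size e)%N -> fps_dvd (nth 0%N e i) (w i)) /\
  (forall i, (i < r)%N -> w (size e + i)%N = 0).
Proof.
elim: e w => [|d e IHe] w /=.
  split=> [/ffunP w0|[_ w0]].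
    by split=> // i lt_ir; have := w0 (Ordinal lt_ir); rewrite !ffunE.
  by apply/ffunP => i; rewrite !ffunE; exact: w0.
split=> [[/fps_mod_eq0 w0 /IHe[ws wr]]|[ws wr]].
  by split=> // -[|i] //; exact: ws.
congr pair; first by apply/fps_mod_eq0; exact: (ws 0%N).
by apply/IHe; split=> // i; exact: (ws i.+1).
Qed.

Lemma elementary_proj_surj e r (q : elementary_module k e r) :
  exists w, elementary_proj e r w = q.
Proof.
elim: e q => [|d e IHe] /= q.
  exists (fun i => if insub i is Some j then q j else 0).
  by apply/ffunP => i; rewrite ffunE valK.
case: q => q1 q2; have [w wE] := IHe q2.
exists (fun i => if i is i'.+1 then w i' else quot_repr q1).
by congr pair => //; exact: quot_reprK.
Qed.

End Elementary.

(** * Truncated power series *)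

Section Truncation.
Variables (k : fieldType) (n : nat).
Local Notation R := {fps k}.
Implicit Types a b : R.

Lemma tpoly_poly_trunc a : tpoly_poly (fps_trunc n a) = fps_poly n a.
Proof.
rewrite /tpoly_poly /fps_trunc in_qpoly_small // mk_monic_Xn size_polyXn ltnS.
exact: size_poly.
Qed.

Lemma coef_fps_trunc a i : (tpoly_poly (fps_trunc n a))`_i = if (i <= n)%N then a i else 0.
Proof. by rewrite tpoly_poly_trunc coef_poly. Qed.

Lemma size_tpoly_poly (p : tpoly k n) : (size (tpoly_poly p) <= n.+1)%N.
Proof.
have szX : size (mk_monic ('X^(n.+1) : {poly k})) = n.+2.
  by rewrite mk_monic_Xn size_polyXn.
by rewrite -ltnS -szX; exact: size_mk_monic p.
Qed.

Lemma tpoly_poly_inj : injective (@tpoly_poly k n).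
Proof. by move=> p q; exact: val_inj. Qed.

Definition tpoly_lift (p : tpoly k n) : R := Fps (fun i => (tpoly_poly p)`_i).

Lemma tpoly_liftK p : fps_trunc n (tpoly_lift p) = p.
Proof.
apply: tpoly_poly_inj; rewrite tpoly_poly_trunc; apply/polyP => i; rewrite coef_poly.
by case: ltnP => // le_i; rewrite nth_default // (leq_trans (size_tpoly_poly p)).
Qed.

Lemma fps_trunc0 : fps_trunc n (0 : R) = 0.
Proof.
by apply: (@addrI _ (fps_trunc n 0)); rewrite -fps_truncD !addr0.
Qed.

Lemma fps_truncN a : fps_trunc n (- a) = - fps_trunc n a.
Proof.
by apply: (@addrI _ (fps_trunc n a)); rewrite -fps_truncD !subrr fps_trunc0.
Qed.

Fact fps_trunc_zmod : zmod_morphism (@fps_trunc k n).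
Proof. by move=> a b; rewrite fps_truncD fps_truncN. Qed.
Fact fps_trunc_monoid : monoid_morphism (@fps_trunc k n).
Proof. by split; [exact: fps_trunc1 | exact: fps_truncM]. Qed.
HB.instance Definition _ := GRing.isZmodMorphism.Build R (tpoly k n) _ fps_trunc_zmod.
HB.instance Definition _ := GRing.isMonoidMorphism.Build R (tpoly k n) _ fps_trunc_monoid.

Lemma fps_trunc_eq a b : fps_trunc n a = fps_trunc n b <-> fps_eqmod n.+1 a b.
Proof.
split=> [eq_ab i lt_i|eq_ab].
  have := congr1 (fun p => (tpoly_poly p)`_i) eq_ab.
  by rewrite !coef_fps_trunc -ltnS lt_i.
rewrite /fps_trunc; congr (in_qpoly _ _); apply/polyP => i; rewrite !coef_poly.
by case: ifP => // /eq_ab.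
Qed.

Lemma fps_trunc_eq0 a : fps_trunc n a = 0 <-> fps_dvd n.+1 a.
Proof. by rewrite -fps_trunc0 fps_trunc_eq fps_eqmodP subr0. Qed.

Lemma fps_trunc_const c : fps_trunc n (fps_const c) = @tpoly_const k n c.
Proof.
apply: tpoly_poly_inj; rewrite tpoly_poly_trunc [RHS]qpolyCE; apply/polyP => i.
by rewrite coef_poly coefC; case: i => [|i] //=; case: ifP.
Qed.

Lemma mmap_arc_trunc N (a : arc_space k N) p :
  mmap (@tpoly_const k n) (arc_trunc n a : {ffun 'I_N -> tpoly k n}) p =
  fps_trunc n (mmap (@fps_const k) a p).
Proof.
rewrite /mmap rmorph_sum; apply: eq_bigr => m _.
rewrite rmorphM /= fps_trunc_const; congr (_ * _).
rewrite /mmap1 rmorph_prod; apply: eq_bigr => i _.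
by rewrite rmorphXn /= ffunE.
Qed.

End Truncation.

(** * Quotients by the rows of a matrix *)

Section RowQuotients.
Variables (k : fieldType) (m N : nat).
Local Notation R := {fps k}.

(** The padding by 0 is never seen: [elementary_proj] only reads positions < N. *)
Definition row_nat (w : 'rV[R]_N) (i : nat) : R :=
  if insub i is Some j then w 0 j else 0.

Lemma row_nat_ord w (j : 'I_N) : row_nat w j = w 0 j.
Proof. by rewrite /row_nat valK. Qed.

Lemma row_nat_linear a w w' : row_nat (a *: w + w') = fun i => a * row_nat w i + row_nat w' i.
Proof.
apply: funext => i; rewrite /row_nat; case: insubP => [j _ _|_]; first by rewrite !mxE.
by rewrite mulr0 addr0.
Qed.

Lemma row_nat_fun (w : nat -> R) i : (i < N)%N -> row_nat (\row_j w j) i = w i.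
Proof. by move=> lt_i; rewrite /row_nat insubT mxE. Qed.

Lemma elementary_proj_eq e r w w' : (forall i, (i < size e + r)%N -> w i = w' i) ->
  elementary_proj e r w = elementary_proj e r w' :> elementary_module k e r.
Proof.
elim: e w w' => [|d e IHe] w w' eq_w /=.
  by apply/ffunP => i; rewrite !ffunE eq_w.
by rewrite eq_w //; congr pair; apply: IHe => i lt_i; exact: eq_w.
Qed.

Lemma elementary_row_surj e r (q : elementary_module k e r) :
  (size e + r <= N)%N -> exists w, elementary_proj e r (row_nat w) = q.
Proof.
move=> le_N; have [w <-] := elementary_proj_surj q; exists (\row_j w j).
by apply: elementary_proj_eq => i lt_i; rewrite row_nat_fun // (leq_trans lt_i).
Qed.

Variables (a : seq nat) (A : 'M[R]_(m, N)) (U : 'M[R]_m) (V V' : 'M[R]_N).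
Hypotheses (size_a : (size a <= minn m N)%N) (VV' : V *m V' = 1%:M).
Hypotheses (iU : mx_invertible U) (AE : A = U *m smith_mx k m N a *m V).

Lemma mulV_surj w : exists v : 'rV[R]_N, v *m V' = w.
Proof. by exists (w *m V); rewrite -mulmxA VV' mulmx1. Qed.

Lemma smith_rowE (c : 'rV[R]_m) (j : 'I_N) (i : 'I_m) : i = j :> nat ->
  (c *m smith_mx k m N a) 0 j = if (j < size a)%N then c 0 i * fps_Xn k (nth 0%N a j) else 0.
Proof.
move=> eq_ij; rewrite mxE (bigD1 i) //= mxE eq_ij eqxx /=.
rewrite big1 ?addr0 => [|i' /negPf ne_i]; first by case: ifP; rewrite ?mulr0.
rewrite mxE (_ : (i' == j :> nat) = false) ?mulr0 //.
by rewrite -eq_ij; exact: ne_i.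
Qed.

Lemma smith_row0 (c : 'rV[R]_m) (j : 'I_N) :
  ~~ (j < size a)%N -> (c *m smith_mx k m N a) 0 j = 0.
Proof.
move=> ge_j; rewrite mxE big1 // => i _; rewrite mxE.
by case: eqP => [->|]; rewrite ?(negPf ge_j) ?mulr0.
Qed.

Lemma row_space_smith (w : 'rV[R]_N) : (exists c, w = c *m smith_mx k m N a) <->
  forall j : 'I_N, if (j < size a)%N then fps_dvd (nth 0%N a j) (w 0 j) else w 0 j = 0.
Proof.
have lt_m j : (j < size a)%N -> (j < m)%N.
  by move=> /leq_trans; apply; apply: leq_trans size_a _; rewrite geq_minl.
split=> [[c ->] j|dvd_w].
  case: ifP => [lt_j|/negbT ge_j]; last exact: smith_row0.
  rewrite (smith_rowE c (i := Ordinal (lt_m _ lt_j))) // lt_j.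
  by exists (c 0 (Ordinal (lt_m _ lt_j))); rewrite mulrC.
have /choice[z zE] : forall j : 'I_N, exists z, (j < size a)%N -> w 0 j = fps_Xn k (nth 0%N a j) * z.
  by move=> j; have := dvd_w j; case: ifP => [_ [z ->]|_ _]; [exists z | exists 0].
exists (\row_i row_nat (\row_j z j) i); apply/rowP => j; have := dvd_w j.
case: ifP => [lt_j _|/negbT ge_j ->]; last by rewrite smith_row0.
rewrite (smith_rowE _ (i := Ordinal (lt_m _ lt_j))) // lt_j mxE /=.
by rewrite (row_nat_ord _ j) mxE mulrC zE.
Qed.

Lemma row_space_equiv (v : 'rV[R]_N) : (exists c, v = c *m A) <->
  exists c, v *m V' = c *m smith_mx k m N a.
Proof.
split=> [[c ->]|[c vE]].
  by exists (c *m U); rewrite AE -!mulmxA VV' mulmx1.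
have [U' UU'] := iU; exists (c *m U').
rewrite AE !mulmxA -(mulmxA c) (mulmx1C UU') mulmx1 -vE.
by rewrite -mulmxA (mulmx1C VV') mulmx1.
Qed.

(** Both modules are quotients of R^N: the rows of A span the vectors v whose
    coordinates v V^-1 are divisible by the diagonal entries of the Smith form. *)
Lemma elementary_iso_arc (h : 'I_m -> {ffun 'I_N -> R^o}) :
    (forall i j, h i j = A i j) ->
  lmod_iso (quot_mod h) (elementary_module k a (N - size a)).
Proof.
move=> hE; have size_aN : (size a <= N)%N by apply: leq_trans size_a _; rewrite geq_minr.
apply: (@lmod_iso_of_ker _ 'rV[R]_N _ _
  (fun v => quot_proj h [ffun j => v 0 j : R^o])
  (fun v => elementary_proj a (N - size a) (row_nat (v *m V')))).
- move=> x u v; rewrite -quot_proj_linear; congr quot_proj.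
  by apply/ffunP => j; rewrite !ffunE !mxE.
- by move=> x u v; rewrite mulmxDl -scalemxAl row_nat_linear elementary_proj_linear.
- move=> q; exists (\row_j quot_repr q j); rewrite -[RHS]quot_reprK; congr quot_proj.
  by apply/ffunP => j; rewrite ffunE mxE.
- move=> q; have [|w <-] := elementary_row_surj q; first by rewrite subnKC.
  by have [v <-] := mulV_surj w; exists v.
move=> v; have -> : (quot_proj h [ffun j => v 0 j : R^o] = 0) <-> exists c, v = c *m A.
  rewrite quot_proj_eq0; split=> [[c vE]|[c ->]].
    exists (\row_i c i); apply/rowP => j; have /ffunP/(_ j) := vE.
    rewrite ffunE sum_ffunE => ->; rewrite mxE; apply: eq_bigr => i _.
    by rewrite ffunE hE mxE.
  exists (fun i => c 0 i); apply/ffunP => j; rewrite ffunE sum_ffunE mxE.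
  by apply: eq_bigr => i _; rewrite ffunE hE.
rewrite row_space_equiv row_space_smith elementary_proj_eq0; split=> [dvd_w|[dvd_w w0] j].
  split=> i lt_i.
    have lt_iN : (i < N)%N by exact: leq_trans lt_i size_aN.
    by rewrite (row_nat_ord _ (Ordinal lt_iN)); have := dvd_w (Ordinal lt_iN); rewrite lt_i.
  have lt_iN : (size a + i < N)%N by rewrite -ltn_subRL.
  rewrite (row_nat_ord _ (Ordinal lt_iN)); have := dvd_w (Ordinal lt_iN).
  by rewrite /= ltnNge leq_addr.
case: ltnP => [lt_j|le_j]; first by rewrite -row_nat_ord; exact: dvd_w.
rewrite -row_nat_ord -(subnKC le_j); apply: w0.
by rewrite ltn_sub2r // (leq_ltn_trans le_j).
Qed.

Variable n : nat.

(* Modulo t^(n+1), exponents are cut off at n+1, and the columns without a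
   diagonal entry contribute summands k[[t]]/(t^(n+1)). *)
Let b := map (minn n.+1) a ++ nseq (N - size a) n.+1.

Lemma size_jet_exponents : size b = N.
Proof.
rewrite size_cat size_map size_nseq subnKC //.
by apply: leq_trans size_a _; rewrite geq_minr.
Qed.

Lemma nth_jet_exponents i : (i < N)%N ->
  nth 0%N b i = if (i < size a)%N then minn n.+1 (nth 0%N a i) else n.+1.
Proof.
move=> lt_iN; rewrite nth_cat size_map; case: ifP => [lt_i|/negbT].
  by rewrite (nth_map 0%N).
by rewrite -leqNgt => le_i; rewrite nth_nseq ltn_sub2r // (leq_ltn_trans le_i).
Qed.

Lemma sorted_jet_exponents : sorted leq a -> sorted leq b.
Proof.
move=> sorted_a; rewrite sorted_pairwise; last exact: leq_trans.
apply/(pairwiseP 0%N) => i j; rewrite !inE size_jet_exponents => lt_i lt_j lt_ij.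
rewrite !nth_jet_exponents //; case: (ltnP j (size a)) => [lt_ja|_]; last first.
  by case: ifP => // _; exact: geq_minl.
rewrite (ltn_trans lt_ij lt_ja) leq_min geq_minl geq_min /=.
by rewrite (sorted_leq_nth leq_trans leqnn) ?orbT ?inE ?(ltn_trans lt_ij) // ltnW.
Qed.

(** As for arcs, with t^(n+1) R^N added to the span of the rows. *)
Lemma elementary_iso_jet (h : 'I_m -> {ffun 'I_N -> tpoly k n}) :
    (forall i j, h i j = fps_trunc n (A i j)) ->
  lmod_iso (quot_mod h) (elementary_module k b 0).
Proof.
move=> hE; have size_aN : (size a <= N)%N by apply: leq_trans size_a _; rewrite geq_minr.
have scaleE (x y : R) : x *: fps_trunc n y = fps_trunc n (x * y).
  by rewrite rmorphM.
apply: (@lmod_iso_of_ker _ 'rV[R]_N _ _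
  (fun v => quot_proj h [ffun j => fps_trunc n (v 0 j)])
  (fun v => elementary_proj b 0 (row_nat (v *m V')))).
- move=> x u v; rewrite -quot_proj_linear; congr quot_proj.
  by apply/ffunP => j; rewrite !ffunE !mxE scaleE rmorphD.
- by move=> x u v; rewrite mulmxDl -scalemxAl row_nat_linear elementary_proj_linear.
- move=> q; exists (\row_j tpoly_lift (quot_repr q j)); rewrite -[RHS]quot_reprK.
  congr quot_proj; apply/ffunP => j; rewrite ffunE mxE; exact: tpoly_liftK.
- move=> q; have [|w <-] := elementary_row_surj q; first by rewrite addn0 size_jet_exponents.
  by have [v <-] := mulV_surj w; exists v.
move=> v; pose t1 := fps_Xn k n.+1.
have subE (w z : 'rV[R]_N) j : (w - t1 *: z) 0 j = w 0 j - t1 * z 0 j by rewrite !mxE.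
have -> : (quot_proj h [ffun j => fps_trunc n (v 0 j)] = 0) <->
    exists z, exists c, v - t1 *: z = c *m A.
  rewrite quot_proj_eq0; split=> [[c vE]|[z [c vE]]].
    have /choice[z zE] : forall j, exists z, v 0 j - \sum_i c i * A i j = t1 * z.
      move=> j; apply/fps_trunc_eq0; rewrite rmorphB rmorph_sum /=; apply/eqP.
      rewrite subr_eq0; apply/eqP; have /ffunP/(_ j) := vE.
      by rewrite ffunE sum_ffunE => ->; apply: eq_bigr => i _; rewrite ffunE hE scaleE.
    exists (\row_j z j), (\row_i c i); apply/rowP => j; rewrite !mxE -zE opprB addrC subrK.
    by apply: eq_bigr => i _; rewrite mxE.
  exists (fun i => c 0 i); apply/ffunP => j; rewrite ffunE sum_ffunE.
  have -> : v 0 j = \sum_i c 0 i * A i j + t1 * z 0 j.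
    have /rowP/(_ j) := vE; rewrite !mxE => <-; by rewrite subrK.
  rewrite rmorphD /= [X in _ + X](_ : _ = 0) ?addr0; last first.
    by apply/fps_trunc_eq0; exists (z 0 j).
  by rewrite rmorph_sum; apply: eq_bigr => i _; rewrite ffunE hE scaleE.
rewrite elementary_proj_eq0 size_jet_exponents; split=> [[z [c]]|[dvd_w _]].
  move=> vE; split=> // i lt_iN; rewrite nth_jet_exponents //.
  have := (row_space_equiv (v - t1 *: z)).1 (ex_intro _ c vE).
  move/row_space_smith/(_ (Ordinal lt_iN)) => /=.
  rewrite mulmxBl -scalemxAl (row_nat_ord _ (Ordinal lt_iN)); set w := v *m V'.
  set z' := z *m V'; rewrite subE => dvd_wz.
  have -> : w 0 (Ordinal lt_iN) = w 0 (Ordinal lt_iN) - t1 * z' 0 (Ordinal lt_iN)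
     + t1 * z' 0 (Ordinal lt_iN) by rewrite subrK.
  have dvd_tz : fps_dvd n.+1 (t1 * z' 0 (Ordinal lt_iN)) by eexists.
  move: dvd_wz; case: ifP => [_ dvd_wz|_ ->]; last by rewrite add0r.
  apply: fps_dvdD; [apply: fps_dvdW dvd_wz | apply: fps_dvdW dvd_tz].
    exact: geq_minr.
  exact: geq_minl.
pose w := v *m V'.
have /choice[z zE] : forall j : 'I_N, exists z, if (j < size a)%N
    then fps_dvd (nth 0%N a j) (w 0 j - t1 * z) else w 0 j - t1 * z = 0.
  move=> j; have := dvd_w j (ltn_ord j); rewrite nth_jet_exponents // row_nat_ord.
  case: ifP => [_|_ [z ->]]; last by exists z; rewrite subrr.
  have [le_a|lt_a] := leqP (nth 0%N a j) n.+1.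
    by move=> dvd_j; exists 0; rewrite mulr0 subr0; apply: fps_dvdW dvd_j.
  by move=> [z ->]; exists z; rewrite subrr; exact: fps_dvd0.
exists (\row_j z j *m V); apply/row_space_equiv; apply/row_space_smith => j.
rewrite mulmxBl -scalemxAl -mulmxA VV' mulmx1 -/w.
by have := zE j; rewrite subE [(\row__ _) 0 j]mxE.
Qed.

End RowQuotients.

(** * The stratum and its truncations *)

Section JetsAndArcs.
Variables (k : fieldType) (N : nat).
Local Notation R := {fps k}.
Implicit Types a : arc_space k N.

Definition jet_lift l (theta : jet_space k N l) : arc_space k N :=
  [ffun j => tpoly_lift ((theta : {ffun 'I_N -> tpoly k l}) j)].

Lemma coef_jet_lift l (theta : jet_space k N l) j s :
  jet_lift theta j s = (tpoly_poly ((theta : {ffun 'I_N -> tpoly k l}) j))`_s.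
Proof. by rewrite ffunE. Qed.

Lemma jet_liftK l theta : arc_trunc l (@jet_lift l theta) = theta.
Proof. by apply/ffunP => j; rewrite !ffunE tpoly_liftK. Qed.

Lemma eq_arc_trunc l a a' : (forall j, fps_eqmod l.+1 (a j) (a' j)) ->
  arc_trunc l a = arc_trunc l a'.
Proof. by move=> eq_aa'; apply/ffunP => j; rewrite !ffunE; exact/fps_trunc_eq. Qed.

Lemma arc_trunc_eq l a a' :
  arc_trunc l a = arc_trunc l a' <-> exists x, a' = arc_add a l.+1 x.
Proof.
split=> [/ffunP eq_aa'|[x ->]].
  have /choice[z zE] : forall j, exists z, a' j - a j = fps_Xn k l.+1 * z.
    move=> j; apply/fps_eqmodP/fps_trunc_eq; have := eq_aa' j.
    by rewrite !ffunE.
  by exists (\col_j z j); apply/ffunP => j; rewrite ffunE mxE -zE addrC subrK.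
apply: eq_arc_trunc => j; apply/fps_eqmodP; rewrite ffunE.
by exists (- x j 0); rewrite opprD addNKr mulrN.
Qed.

Lemma jet_trunc_arc n l a : (l <= n)%N -> jet_trunc l (arc_trunc n a) = arc_trunc l a.
Proof.
move=> le_ln; apply/ffunP => j; rewrite !ffunE in_qpoly_take.
rewrite [RHS]in_qpoly_take; congr (in_qpoly _ _); apply/polyP => i.
rewrite !coef_take_poly; case: ifP => // lt_i.
by rewrite coef_fps_trunc coef_poly lt_i (leq_trans _ le_ln).
Qed.

Lemma coef_arc_trunc l a j s : (s <= l)%N ->
  (tpoly_poly ((arc_trunc l a : {ffun 'I_N -> tpoly k l}) j))`_s = a j s.
Proof. by move=> le_sl; rewrite ffunE coef_fps_trunc le_sl. Qed.

Lemma coef_jet_trunc n l (theta : jet_space k N n) j s : (l <= n)%N -> (s <= l)%N ->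
  (tpoly_poly ((jet_trunc l theta : {ffun 'I_N -> tpoly k l}) j))`_s = jet_lift theta j s.
Proof.
move=> le_ln le_sl; rewrite -{1}[theta]jet_liftK (jet_trunc_arc _ le_ln).
exact: coef_arc_trunc.
Qed.

Lemma jet_trunc_trunc n l l' (theta : jet_space k N n) : (l <= l')%N -> (l' <= n)%N ->
  jet_trunc l (jet_trunc l' theta) = jet_trunc l theta.
Proof.
move=> le_l le_l'; rewrite -[theta]jet_liftK !jet_trunc_arc //.
exact: leq_trans le_l'.
Qed.

Lemma coef_arc_add a s x j n : (arc_add a s x j : R) n =
  a j n + (if (n < s)%N then 0 else x j 0 (n - s)%N).
Proof. by rewrite ffunE coef_fpsD coef_fpsXnM. Qed.

Lemma arc_addN a s x : a = arc_add (arc_add a s x) s (- x).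
Proof. by apply/ffunP => j; rewrite !ffunE mxE mulrN addrK. Qed.

End JetsAndArcs.

Section Strata.
Variables (k : fieldType) (N m : nat) (IX : set {mpoly k[N]}).
Variables (f : 'I_m -> {mpoly k[N]}) (e : seq nat).
Hypotheses (hIX : IX = ideal_gen f) (le_mN : (m <= N)%N).
Hypotheses (sorted_e : sorted leq e) (size_e : size e = m).
Local Notation R := {fps k}.
Local Notation em := (last 0%N e).
Local Notation has_type A := (mx_equiv A (smith_mx k m N e)).
Implicit Types a : arc_space k N.

(** A matrix with the right quotient has some Smith form; its exponents are e
    because isomorphic sums of cyclic modules have equal exponents. *)
Lemma arc_invariantsP a : arc_invariants f a e <-> has_type (jacobian f a).
Proof.
have jacE (i : 'I_m) (j : 'I_N) : arc_jacobian f a i j = jacobian f a i j.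
  by rewrite ffunE mxE.
split=> [[_ _ iso_e]|[U [V [iU [V' VV'] AE]]]].
  have [b [sorted_b size_b Jb]] := smith_normal_form (jacobian f a).
  have [U [V [iU [V' VV'] AE]]] := Jb.
  have iso_b := elementary_iso_arc size_b VV' iU AE jacE.
  suff -> : e = b by [].
  apply: elementary_module_inj (lmod_iso_trans (lmod_iso_sym iso_e) iso_b) => //.
  rewrite !subnKC ?size_e //.
  by apply: leq_trans size_b _; rewrite geq_minr.
have le_e : (size e <= minn m N)%N by rewrite size_e leq_min leqnn.
by split=> //; have := elementary_iso_arc le_e VV' iU AE jacE.
Qed.

(** The exponents of the jet are those of a lift cut off at n+1. As e_m <= n, an
    exponent equal to some e_i has not been cut off. *)
Lemma jet_invariantsP n a : (em <= n)%N ->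
  let g := if odd n then n.+1./2 else n./2 in
  (exists s, [/\ jet_invariants f (arc_trunc n a) s,
     forall i, (i < size e)%N -> nth 0%N s i = nth 0%N e i &
     (size e < N)%N -> (g <= nth 0%N s (size e))%N]) <-> has_type (jacobian f a).
Proof.
move=> le_en g; have jacE (i : 'I_m) (j : 'I_N) :
    jet_jacobian f (arc_trunc n a) i j = fps_trunc n (jacobian f a i j).
  by rewrite ffunE mxE mmap_arc_trunc.
have lt_e i : (nth 0%N e i < n.+1)%N.
  by rewrite ltnS (leq_trans _ le_en) // nth_le_last.
split=> [[s [[size_s sorted_s _ iso_s] eq_se _]]|[U [V [iU [V' VV'] AE]]]].
  have [b [sorted_b size_b Jb]] := smith_normal_form (jacobian f a).
  have [U [V [iU [V' VV'] AE]]] := Jb.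
  have iso_b := elementary_iso_jet size_b VV' iU AE jacE.
  have sE := elementary_module_inj sorted_s (sorted_jet_exponents size_b n sorted_b) _
    (lmod_iso_trans (lmod_iso_sym iso_s) iso_b).
  rewrite size_s (size_jet_exponents size_b) in sE; have {}sE := sE erefl.
  have nth_b i : (i < m)%N -> (i < size b)%N /\ nth 0%N b i = nth 0%N e i.
    move=> lt_i; have lt_iN := leq_trans lt_i le_mN.
    have := eq_se i; rewrite size_e => /(_ lt_i).
    rewrite sE nth_jet_exponents //; have := lt_e i.
    case: ifP => [_ lt_ei|_ + eq_ei]; last by rewrite -eq_ei ltnn.
    rewrite /minn; case: ltnP => [_ eq_ei|_ ->] //.
    by rewrite -eq_ei ltnn in lt_ei.
  have size_bm : size b = m.
    apply/eqP; rewrite eqn_leq (leq_trans size_b (geq_minl _ _)) /= leqNgt.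
    by apply/negP => /[dup] /nth_b[]; rewrite ltnn.
  suff -> : e = b by [].
  apply: (@eq_from_nth _ 0%N); first by rewrite size_e.
  by rewrite size_e => i /nth_b[].
have le_e : (size e <= minn m N)%N by rewrite size_e leq_min leqnn.
exists (map (minn n.+1) e ++ nseq (N - size e) n.+1); split.
- split; first exact: (size_jet_exponents le_e).
  + exact: (sorted_jet_exponents le_e).
  + move=> d; rewrite mem_cat => /orP[/mapP[d' _ ->]|]; first exact: geq_minl.
    by move=> /nseqP[->].
  exact: (elementary_iso_jet le_e VV' iU AE jacE).
- move=> i lt_i; rewrite nth_jet_exponents ?lt_i; last first.
    by rewrite size_e in lt_i; exact: leq_trans lt_i le_mN.
  by apply/minn_idPr; exact: ltnW.
move=> lt_e'; rewrite nth_jet_exponents // ltnn /g.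
by case: ifP => _; rewrite -divn2 (leq_trans (leq_div _ _)).
Qed.

End Strata.

Section StratumImages.
Variables (k : fieldType) (N m : nat) (IX : set {mpoly k[N]}).
Variables (f : 'I_m -> {mpoly k[N]}) (e : seq nat).
Hypotheses (hIX : IX = ideal_gen f) (le_mN : (m <= N)%N).
Hypotheses (sorted_e : sorted leq e) (size_e : size e = m).
Local Notation R := {fps k}.
Local Notation em := (last 0%N e).
Local Notation has_type A := (mx_equiv A (smith_mx k m N e)).
Implicit Types a : arc_space k N.

Lemma arcsP a : arcs IX a <-> equations f a = 0.
Proof.
rewrite hIX; split=> [arc_a|eq_a h [c ->]].
  apply/colP => i; rewrite !mxE; apply: arc_a; exists (fun j => (j == i)%:R).
  rewrite (bigD1 i) //= eqxx mul1r big1 ?addr0 // => j /negPf->.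
  by rewrite mul0r.
rewrite rmorph_sum big1 // => i _; rewrite rmorphM /=.
by have /colP/(_ i) := eq_a; rewrite !mxE => ->; rewrite mulr0.
Qed.

Lemma jetsP n a :
  jets IX (arc_trunc n a) <-> exists c, equations f a = fps_Xn k n.+1 *: c.
Proof.
rewrite hIX; split=> [jet_a|[c eq_a] h [d ->]].
  have /choice[c cE] : forall i, exists c, equations f a i 0 = fps_Xn k n.+1 * c.
    move=> i; apply/fps_trunc_eq0; rewrite mxE -mmap_arc_trunc; apply: jet_a.
    exists (fun j => (j == i)%:R).
    rewrite (bigD1 i) //= eqxx mul1r big1 ?addr0 // => j /negPf->.
    by rewrite mul0r.
  by exists (\col_i c i); apply/colP => i; rewrite cE !mxE.
rewrite mmap_arc_trunc; apply/fps_trunc_eq0; rewrite rmorph_sum.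
apply: fps_dvd_sum => i _; rewrite rmorphM; apply: fps_dvdMl.
by exists (c i 0); have /colP/(_ i) := eq_a; rewrite !mxE.
Qed.

Local Notation L l := (arc_stratum_image IX f l e).

(** Necessity is Taylor's formula at an arc of the stratum with the same l-jet
    ([liftable_arc_add] with f = 0 there), and sufficiency is [hensel]. *)
Theorem arc_stratum_imageP l a : (em <= l)%N ->
  L l (arc_trunc l a) <-> has_type (jacobian f a) /\ liftable f l.+1 a.
Proof.
move=> le_el; split=> [[gamma [arc_gamma /arc_invariantsP type_gamma] trunc_eq]|].
  have /type_gamma{}type_gamma := le_mN.
  have {}type_gamma := type_gamma sorted_e size_e.
  have [x aE] := (arc_trunc_eq l gamma a).1 trunc_eq.
  have type_a : has_type (jacobian f a) by rewrite aE; exact: has_type_arc_add.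
  split=> //; apply: (liftable_arc_add sorted_e size_e le_mN (x := - x)) => //.
  rewrite {1}aE -arc_addN; exists 0.
  by rewrite mulmx0 scaler0; exact/arcsP.
move=> [type_a /(hensel sorted_e size_e le_mN _ type_a)[] // x eq0].
exists (arc_add a l.+1 x); last by apply/esym/arc_trunc_eq; exists x.
split; first exact/arcsP.
apply/(arc_invariantsP f le_mN sorted_e size_e).
exact: (has_type_arc_add sorted_e size_e le_mN x _ type_a).
Qed.

Lemma stratum_image_trunc n l theta : (l <= n)%N -> L n theta -> L l (jet_trunc l theta).
Proof.
move=> le_ln [gamma gammaL <-]; rewrite jet_trunc_arc //.
by exists gamma.
Qed.

(** f(a) is divisible by t^(l+i+1), and t^i R^m lies in the image of the Jacobian
    because e_m <= i; the converse is truncation. *)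
Lemma jet_stratum_image l i : (em <= l)%N -> (em <= i)%N ->
  jet_trunc l @` jet_stratum IX f (l + i) e = L l.
Proof.
move=> le_el le_ei; have le_eli : (em <= l + i)%N by rewrite (leq_trans le_el) ?leq_addr.
apply/predeqP => theta; split=> [[theta' [jet_theta inv_theta] <-]|[gamma [arc_g inv_g] <-]].
  move: jet_theta inv_theta; rewrite -[theta']jet_liftK; set a := jet_lift theta'.
  rewrite jet_trunc_arc ?leq_addr // => /jetsP[c eq_a] inv_a.
  have type_a : has_type (jacobian f a) by apply/(jet_invariantsP _ _ _ _ _ le_eli).
  apply/arc_stratum_imageP => //; split=> //.
  have [K JK] := type_right_inverse sorted_e size_e le_mN type_a.
  exists (fps_Xn k (i - em) *: (K *m c)).
  rewrite eq_a -scalemxAr mulmxA JK mul_scalar_mx scalerA -fps_XnD subnK //.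
  by rewrite scalerA -fps_XnD addSn.
exists (arc_trunc (l + i) gamma); last by rewrite jet_trunc_arc ?leq_addr.
split; last by apply/jet_invariantsP => //; apply/arc_invariantsP.
by apply/jetsP; exists 0; rewrite scaler0; exact/arcsP.
Qed.

End StratumImages.

(** * Polynomial functions and Zariski-closed sets *)

Section PolynomialFunctions.
Variables (k : fieldType) (X : affine_space k).
Local Notation R := {fps k}.

Definition polynomial_fun (h : X -> k) : Prop := exists p, forall x, h x = poly_at p x.

Lemma polynomial_fun_coord j : polynomial_fun (fun x => acoord x 0 j).
Proof. by exists 'X_j => x; rewrite /poly_at mevalXU. Qed.

Lemma polynomial_fun_cst c : polynomial_fun (fun=> c).
Proof. by exists c%:MP => x; rewrite /poly_at mevalC. Qed.

Lemma polynomial_funD h h' : polynomial_fun h -> polynomial_fun h' ->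
  polynomial_fun (fun x => h x + h' x).
Proof.
move=> [p hE] [q h'E]; exists (p + q) => x.
by rewrite hE h'E /poly_at mevalD.
Qed.

Lemma polynomial_funM h h' : polynomial_fun h -> polynomial_fun h' ->
  polynomial_fun (fun x => h x * h' x).
Proof.
move=> [p hE] [q h'E]; exists (p * q) => x.
by rewrite hE h'E /poly_at mevalM.
Qed.

Lemma polynomial_fun_sum I (r : seq I) (P : pred I) (F : I -> X -> k) :
  (forall i, polynomial_fun (F i)) -> polynomial_fun (fun x => \sum_(i <- r | P i) F i x).
Proof.
move=> polF; elim: r => [|i r IHr].
  by under eq_fun do rewrite big_nil; exact: polynomial_fun_cst.
under eq_fun do rewrite big_cons; case: (P i) => //.
exact: polynomial_funD.
Qed.

Definition polynomial_series (F : X -> R) : Prop := forall n, polynomial_fun (fun x => F x n).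

Lemma polynomial_series_cst c : polynomial_series (fun=> c).
Proof. by move=> n; exact: polynomial_fun_cst. Qed.

Lemma polynomial_seriesD F G : polynomial_series F -> polynomial_series G ->
  polynomial_series (fun x => F x + G x).
Proof. by move=> polF polG n; exact: polynomial_funD. Qed.

Lemma polynomial_seriesM F G : polynomial_series F -> polynomial_series G ->
  polynomial_series (fun x => F x * G x).
Proof.
by move=> polF polG n; apply: polynomial_fun_sum => i; exact: polynomial_funM.
Qed.

Lemma polynomial_series_sum I (r : seq I) (P : pred I) (F : I -> X -> R) :
  (forall i, polynomial_series (F i)) ->
  polynomial_series (fun x => \sum_(i <- r | P i) F i x).
Proof.
move=> polF; elim: r => [|i r IHr].
  by under eq_fun do rewrite big_nil; exact: polynomial_series_cst.
under eq_fun do rewrite big_cons; case: (P i) => //.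
exact: polynomial_seriesD.
Qed.

Lemma polynomial_series_prod I (r : seq I) (P : pred I) (F : I -> X -> R) :
  (forall i, polynomial_series (F i)) ->
  polynomial_series (fun x => \prod_(i <- r | P i) F i x).
Proof.
move=> polF; elim: r => [|i r IHr].
  by under eq_fun do rewrite big_nil; exact: polynomial_series_cst.
under eq_fun do rewrite big_cons; case: (P i) => //.
exact: polynomial_seriesM.
Qed.

Lemma polynomial_series_mmap N (a : X -> arc_space k N) p :
  (forall j, polynomial_series (fun x => a x j)) ->
  polynomial_series (fun x => mmap (@fps_const k) (a x) p).
Proof.
move=> pol_a; apply: polynomial_series_sum => mon; apply: polynomial_seriesM.
  exact: polynomial_series_cst.
apply: polynomial_series_prod => i; elim: (mon i) => [|d IHd].
  exact: polynomial_series_cst.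
by under eq_fun do rewrite exprS; exact: polynomial_seriesM.
Qed.

Definition polynomial_mx m n (A : X -> 'M[R]_(m, n)) : Prop :=
  forall i j, polynomial_series (fun x => A x i j).

Lemma polynomial_mxM m n p (A : X -> 'M[R]_(m, n)) (B : X -> 'M[R]_(n, p)) :
  polynomial_mx A -> polynomial_mx B -> polynomial_mx (fun x => A x *m B x).
Proof.
move=> polA polB i j; under eq_fun do rewrite mxE.
by apply: polynomial_series_sum => l; exact: polynomial_seriesM.
Qed.

Lemma polynomial_mxD m n (A B : X -> 'M[R]_(m, n)) :
  polynomial_mx A -> polynomial_mx B -> polynomial_mx (fun x => A x + B x).
Proof. by move=> polA polB i j; under eq_fun do rewrite mxE; exact: polynomial_seriesD. Qed.

Lemma polynomial_mxZ m n c (A : X -> 'M[R]_(m, n)) :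
  polynomial_mx A -> polynomial_mx (fun x => c *: A x).
Proof.
move=> polA i j; under eq_fun do rewrite mxE; apply: polynomial_seriesM => //.
exact: polynomial_series_cst.
Qed.

Lemma polynomial_mx_sub m n m' n' (A : X -> 'M[R]_(m, n)) (r : 'I_m' -> 'I_m) (c : 'I_n' -> 'I_n) :
  polynomial_mx A -> polynomial_mx (fun x => mxsub r c (A x)).
Proof. by move=> polA i j; under eq_fun do rewrite mxE; exact: polA. Qed.

Lemma polynomial_det n (A : X -> 'M[R]_n) :
  polynomial_mx A -> polynomial_series (fun x => \det (A x)).
Proof.
move=> polA; apply: polynomial_series_sum => s; apply: polynomial_seriesM.
  exact: polynomial_series_cst.
by apply: polynomial_series_prod.
Qed.

Lemma polynomial_adj n (A : X -> 'M[R]_n) :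
  polynomial_mx A -> polynomial_mx (fun x => \adj (A x)).
Proof.
move=> polA i j; under eq_fun do rewrite mxE; apply: polynomial_seriesM.
  exact: polynomial_series_cst.
apply: polynomial_det => i' j'; under eq_fun do rewrite !mxE.
exact: polA.
Qed.

Lemma zariski_closed_zero h : polynomial_fun h -> zariski_closed [set x | h x = 0].
Proof.
move=> [p hE]; exists [set p]; apply/predeqP => x /=; rewrite hE.
by split=> [px0 q ->|->].
Qed.

Lemma zariski_closed_forall (I : Type) (F : I -> set X) :
  (forall i, zariski_closed (F i)) -> zariski_closed [set x | forall i, F i x].
Proof.
move=> /choice[P FE]; exists [set p | exists i, P i p]; apply/predeqP => x /=.
split=> [Fx p [i Pip]|zx i]; last by rewrite (FE i) => p Pip; apply: zx; exists i.
by have := Fx i; rewrite (FE i); apply.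
Qed.

Lemma zariski_closedI (A B : set X) :
  zariski_closed A -> zariski_closed B -> zariski_closed (A `&` B).
Proof.
move=> clA clB; pose F (b : bool) := if b then A else B.
have -> : A `&` B = [set x | forall b, F b x].
  apply/predeqP => x; split=> [[Ax Bx] []//|Fx].
  by split; [exact: (Fx true) | exact: (Fx false)].
by apply: zariski_closed_forall => -[].
Qed.

(** A union is cut out by the products of equations of the two sets. *)
Lemma zariski_closedU (A B : set X) :
  zariski_closed A -> zariski_closed B -> zariski_closed (A `|` B).
Proof.
move=> [P ->] [Q ->]; exists [set r | exists p q, [/\ P p, Q q & r = p * q]].
apply/predeqP => x; split=> [[zx|zx] _ [p [q [Pp Qq ->]]]|zx].
- by rewrite /poly_at mevalM -/(poly_at p x) zx // mul0r.
- by rewrite /poly_at mevalM -/(poly_at q x) zx // mulr0.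
have [|/existsNP[p /not_implyP[Pp px]]] := pselect (forall p, P p -> poly_at p x = 0).
  by left.
right=> q Qq; have /eqP : poly_at (p * q) x = 0 by apply: zx; exists p, q.
by rewrite /poly_at mevalM mulf_eq0 => /orP[/eqP /px //|/eqP].
Qed.

Lemma zariski_closed_exists n (F : 'I_n -> set X) :
  (forall i, zariski_closed (F i)) -> zariski_closed [set x | exists i, F i x].
Proof.
elim: n F => [|n IHn] F clF.
  exists [set 1]; apply/predeqP => x; split=> [[[]] //|/(_ _ erefl)/eqP].
  by rewrite /poly_at meval1 oner_eq0.
have -> : [set x | exists i, F i x] =
    F ord0 `|` [set x | exists i, F (lift ord0 i) x].
  apply/predeqP => x; split=> [[i]|[F0|[i Fi]]]; last 2 first.
  - by exists ord0.
  - by exists (lift ord0 i).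
  by case: (unliftP ord0 i) => [j|] -> ?; [right; exists j | left].
by apply: zariski_closedU => //; exact: IHn.
Qed.

End PolynomialFunctions.

Section JetFunctions.
Variables (k : fieldType) (N l : nat).

Lemma jet_coordE (theta : jet_space k N l) j (s : 'I_l.+1) :
  acoord theta 0 (mxvec_index j s) =
  (tpoly_poly ((theta : {ffun 'I_N -> tpoly k l}) j))`_s.
Proof. by rewrite /= /jet_coord mxvecE !mxE. Qed.

Lemma polynomial_jet_lift (X : affine_space k) (u : X -> jet_space k N l) :
    (forall c, polynomial_fun (fun x => acoord (u x) 0 c)) ->
  forall j, polynomial_series (fun x => jet_lift (u x) j).
Proof.
move=> pol_u j s; have [lt_s|le_s] := ltnP s l.+1.
  have [p pE] := pol_u (mxvec_index j (Ordinal lt_s)).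
  by exists p => x; rewrite -pE jet_coordE ffunE.
under eq_fun => x.
  rewrite ffunE /= nth_default ?(leq_trans (size_tpoly_poly _)) //; over.
exact: polynomial_fun_cst.
Qed.

End JetFunctions.

(** * Local closedness of the truncated stratum *)

Section LocallyClosed.
Variables (k : fieldType) (N m : nat) (IX : set {mpoly k[N]}).
Variables (f : 'I_m -> {mpoly k[N]}) (e : seq nat).
Hypotheses (hIX : IX = ideal_gen f) (le_mN : (m <= N)%N).
Hypotheses (sorted_e : sorted leq e) (size_e : size e = m).
Local Notation R := {fps k}.
Local Notation em := (last 0%N e).
Local Notation L l := (arc_stratum_image IX f l e).

Section PolynomialArcs.
Variables (X : affine_space k) (a : X -> arc_space k N).
Hypothesis pol_a : forall j, polynomial_series (fun x => a x j).

Lemma polynomial_jacobian : polynomial_mx (fun x => jacobian f (a x)).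
Proof. by move=> i j; under eq_fun do rewrite mxE; exact: polynomial_series_mmap. Qed.

Lemma polynomial_equations : polynomial_mx (fun x => equations f (a x)).
Proof. by move=> i j; under eq_fun do rewrite mxE; exact: polynomial_series_mmap. Qed.

Lemma polynomial_minor_coef g :
  polynomial_fun (fun x => minor_coef e g (jacobian f (a x))).
Proof. apply: polynomial_det; apply: polynomial_mx_sub; exact: polynomial_jacobian. Qed.

End PolynomialArcs.

Section Level.
Variable l : nat.
Local Notation J theta := (jacobian f (@jet_lift k N l theta)).

Let pol_lift := polynomial_jet_lift (@polynomial_fun_coord k (jet_space k N l)).

Definition minors_coef0 (r : 'I_m.+1) s : set (jet_space k N l) :=
  [set theta | forall rc : ('I_r -> 'I_m) * ('I_r -> 'I_N),
     \det (mxsub rc.1 rc.2 (J theta)) s = 0].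

Lemma closed_minors_coef0 r s : zariski_closed (minors_coef0 r s).
Proof.
apply: zariski_closed_forall => rc; apply: zariski_closed_zero.
apply: polynomial_det; apply: polynomial_mx_sub.
exact: polynomial_jacobian pol_lift.
Qed.

(** The vanishing of the second factor characterises the truncated stratum only
    where the minor selected by [g] has least order; the first factor makes the
    condition void elsewhere. *)
Definition equations_coef0 (g : {ffun 'I_m -> 'I_N}) i s : set (jet_space k N l) :=
  [set theta | minor_coef e g (J theta) *
     (\adj (colsub g (J theta)) *m equations f (jet_lift theta)) i 0 s = 0].

Lemma closed_equations_coef0 g i s : zariski_closed (equations_coef0 g i s).
Proof.
apply: zariski_closed_zero; apply: polynomial_funM.
  exact: polynomial_minor_coef pol_lift g.
apply: polynomial_mxM; last exact: polynomial_equations pol_lift.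
apply: polynomial_adj; apply: polynomial_mx_sub.
exact: polynomial_jacobian pol_lift.
Qed.

(** The open part says that, for each r <= m, some r-minor has the least order
    allowed; the closed part says that no r-minor has a smaller order and that the
    equations lie in t^(l+1) times the image of the Jacobian. *)
Lemma locally_closed_stratum_image : (em <= l)%N -> locally_closed (L l).
Proof.
move=> le_el; pose E (r : nat) := sumn (take r e).
pose C1 := [set theta | forall rs : {r : 'I_m.+1 & 'I_(E r)},
              minors_coef0 (tag rs) (tagged rs) theta].
pose C2 := [set theta | forall gis : ({ffun 'I_m -> 'I_N} * 'I_m) * 'I_(sumn e + l.+1),
              equations_coef0 gis.1.1 gis.1.2 gis.2 theta].
exists (~` [set theta | exists r : 'I_m.+1, minors_coef0 r (E r) theta]), (C1 `&` C2).
split.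
- rewrite /zariski_open setCK.
  by apply: zariski_closed_exists => r; exact: closed_minors_coef0.
- apply: zariski_closedI; apply: zariski_closed_forall => i.
    exact: closed_minors_coef0.
  exact: closed_equations_coef0.
apply/predeqP => theta; rewrite -{1}[theta]jet_liftK.
rewrite (arc_stratum_imageP hIX le_mN sorted_e size_e _ le_el).
rewrite smith_minorsP //; split=> [[minors_J lift_theta]|[O [Ctheta1 Ctheta2]]].
  split; [|split].
  - move=> [r min0]; have [dvd_r []] := minors_J r.
    by move=> h c; apply: fps_dvdS => //; exact: (min0 (h, c)).
  - move=> [r s] /= [h c]; have [dvd_r _] := minors_J r.
    by have /fps_dvdP := dvd_r h c; apply.
  move=> [[g i] s]; rewrite /equations_coef0 /=.
  have [->|g0] := eqVneq (minor_coef e g (J theta)) 0; first by rewrite mul0r.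
  have type_J : mx_equiv (J theta) (smith_mx k m N e) by apply/smith_minorsP.
  have [/(_ lift_theta)/(_ i)/fps_dvdP dvd_eq _] :=
    column_space_minors sorted_e size_e le_mN l.+1 (equations f (jet_lift theta)) type_J g0.
  by rewrite dvd_eq ?mulr0.
have minors_J (r : 'I_m.+1) : minors_dvd r (E r) (J theta) /\ ~ minors_dvd r (E r).+1 (J theta).
  split=> [h c|dvd_r].
    apply/fps_dvdP => s lt_s.
    have := Ctheta1 (Tagged (fun r : 'I_m.+1 => 'I_(E r)) (Ordinal lt_s)).
    by move=> /(_ (h, c)).
  apply: O; exists r => -[h c] /=.
  by have /fps_dvdP := dvd_r h c; apply.
split=> //.
have type_J : mx_equiv (J theta) (smith_mx k m N e) by apply/smith_minorsP.
have [g g0] := minor_coef_exists sorted_e size_e le_mN type_J.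
apply/(column_space_minors sorted_e size_e le_mN _ _ type_J g0) => i.
apply/fps_dvdP => s lt_s; have := Ctheta2 (g, i, Ordinal lt_s).
by rewrite /equations_coef0 /= => /eqP; rewrite mulf_eq0 (negPf g0) => /eqP.
Qed.

End Level.

End LocallyClosed.

(** * Regular maps and fibrations *)

Section RegularFunctions.
Variables (k : fieldType) (X : affine_space k) (A : set X).
Implicit Types h : X -> k.

Lemma regular_ext h h' : (forall x, A x -> h x = h' x) ->
  regular_function A h -> regular_function A h'.
Proof.
move=> eq_h reg_h a Aa; have [p [q [qa hE]]] := reg_h a Aa.
by exists p, q; split=> // x Ax qx; rewrite -eq_h // hE.
Qed.

Lemma regular_polynomial h : polynomial_fun h -> regular_function A h.
Proof.
move=> [p hE] a Aa; exists p, 1; rewrite /poly_at meval1; split.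
  by move/eqP; rewrite oner_eq0.
by move=> x Ax _; rewrite hE meval1 divr1.
Qed.

Lemma regular_cst c : regular_function A (fun=> c).
Proof. exact/regular_polynomial/polynomial_fun_cst. Qed.

Lemma regular_coord j : regular_function A (fun x => acoord x 0 j).
Proof. exact/regular_polynomial/polynomial_fun_coord. Qed.

Lemma regularD h h' : regular_function A h -> regular_function A h' ->
  regular_function A (fun x => h x + h' x).
Proof.
move=> reg_h reg_h' a Aa; have [p [q [/eqP qa hE]]] := reg_h a Aa.
have [p' [q' [/eqP qa' hE']]] := reg_h' a Aa.
exists (p * q' + p' * q), (q * q'); rewrite {1}/poly_at mevalM; split.
  by apply/eqP; rewrite mulf_neq0.
move=> x Ax; rewrite /poly_at mevalM mevalD !mevalM => /eqP.
rewrite mulf_eq0 negb_or => /andP[qx qx'].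
by rewrite hE ?hE' //; try exact/eqP; rewrite /poly_at addf_div.
Qed.

Lemma regularM h h' : regular_function A h -> regular_function A h' ->
  regular_function A (fun x => h x * h' x).
Proof.
move=> reg_h reg_h' a Aa; have [p [q [/eqP qa hE]]] := reg_h a Aa.
have [p' [q' [/eqP qa' hE']]] := reg_h' a Aa.
exists (p * p'), (q * q'); rewrite {1}/poly_at mevalM; split.
  by apply/eqP; rewrite mulf_neq0.
move=> x Ax; rewrite /poly_at !mevalM => /eqP.
rewrite mulf_eq0 negb_or => /andP[qx qx'].
by rewrite hE ?hE' //; try exact/eqP; rewrite /poly_at mulf_div.
Qed.

Lemma regularV h : (forall x, A x -> h x <> 0) ->
  regular_function A h -> regular_function A (fun x => (h x)^-1).
Proof.
move=> h_neq0 reg_h a Aa; have [p [q [qa hE]]] := reg_h a Aa.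
have pa : poly_at p a <> 0.
  by move=> pa; apply: (h_neq0 a Aa); rewrite hE // pa mul0r.
exists (q * q), (q * p); rewrite {1}/poly_at mevalM; split.
  by apply/eqP; apply: mulf_neq0; exact/eqP.
move=> x Ax; rewrite /poly_at !mevalM => /eqP; rewrite mulf_eq0 negb_or => /andP[qx px].
by rewrite hE ?invf_div ?/poly_at -?mulf_div ?divff ?mul1r //; exact/eqP.
Qed.

Lemma regular_sum I (r : seq I) (P : pred I) (F : I -> X -> k) :
  (forall i, regular_function A (F i)) ->
  regular_function A (fun x => \sum_(i <- r | P i) F i x).
Proof.
move=> regF; elim: r => [|i r IHr].
  by under eq_fun do rewrite big_nil; exact: regular_cst.
under eq_fun do rewrite big_cons; case: (P i) => //.
exact: regularD.
Qed.

Lemma regular_prod I (r : seq I) (P : pred I) (F : I -> X -> k) :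
  (forall i, regular_function A (F i)) ->
  regular_function A (fun x => \prod_(i <- r | P i) F i x).
Proof.
move=> regF; elim: r => [|i r IHr].
  by under eq_fun do rewrite big_nil; exact: regular_cst.
under eq_fun do rewrite big_cons; case: (P i) => //.
exact: regularM.
Qed.

End RegularFunctions.

Section RegularMaps.
Variable k : fieldType.
Implicit Types X Y Z F : affine_space k.

Definition regular_map X Y (A : set X) (phi : X -> Y) : Prop :=
  forall j, regular_function A (fun x => acoord (phi x) 0 j).

Lemma regular_map_poly X Y (A : set X) (phi : X -> Y) p :
  regular_map A phi -> regular_function A (fun x => poly_at p (phi x)).
Proof.
move=> reg_phi; apply: regular_sum => mon; apply: regularM; first exact: regular_cst.
apply: regular_prod => i; elim: (mon i) => [|d IHd]; first exact: regular_cst.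
by under eq_fun do rewrite exprS; exact: regularM.
Qed.

(** If h = p/q near phi(a), then p(phi) and q(phi) are themselves quotients
    p1/q1 and p2/q2 near a, and h(phi) = p1 q2 / (q1 p2) where p2, q1 and q2 do not
    vanish; the extra factor q2 of the denominator records the last condition. *)
Lemma regular_comp X Y (A : set X) (B : set Y) (phi : X -> Y) h :
    (forall x, A x -> B (phi x)) -> regular_map A phi -> regular_function B h ->
  regular_function A (fun x => h (phi x)).
Proof.
move=> AB reg_phi reg_h a Aa; have [p [q [qa hE]]] := reg_h _ (AB a Aa).
have [p1 [q1 [/eqP q1a pE]]] := regular_map_poly p reg_phi Aa.
have [p2 [q2 [/eqP q2a qE]]] := regular_map_poly q reg_phi Aa.
have p2a : poly_at p2 a != 0.
  by apply/eqP => p2a; apply: qa; rewrite qE ?p2a ?mul0r //; exact/eqP.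
exists (p1 * (q2 * q2)), ((q1 * p2) * q2); rewrite {1}/poly_at !mevalM; split.
  by apply/eqP; rewrite !mulf_neq0.
move=> x Ax; rewrite /poly_at !mevalM => /eqP; rewrite !mulf_eq0 !negb_or.
rewrite -!/(poly_at _ _) => /andP[/andP[q1x p2x] q2x].
have qx : poly_at q (phi x) != 0.
  by rewrite qE //; [rewrite mulf_neq0 ?invr_eq0 | exact/eqP].
rewrite hE; [|exact: AB|exact/eqP].
rewrite pE //; last exact/eqP.
rewrite qE //; last exact/eqP.
by rewrite invf_div mulf_div [in RHS]mulrA -[RHS]mulf_div divff ?mulr1.
Qed.

Lemma regular_map_comp X Y Z (A : set X) (B : set Y) (phi : X -> Y) (psi : Y -> Z) :
    (forall x, A x -> B (phi x)) -> regular_map A phi -> regular_map B psi ->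
  regular_map A (fun x => psi (phi x)).
Proof.
move=> AB reg_phi reg_psi j.
exact: (regular_comp (h := fun y => acoord (psi y) 0 j) AB reg_phi).
Qed.

Lemma regular_map_fst X Y F (A : set X) (phi : X -> prod_space Y F) :
  regular_map A phi -> regular_map A (fun x => (phi x).1).
Proof.
move=> reg_phi j; have := reg_phi (lshift _ j); apply: regular_ext => x _.
by rewrite /= /prod_coord row_mxEl.
Qed.

Lemma regular_map_snd X Y F (A : set X) (phi : X -> prod_space Y F) :
  regular_map A phi -> regular_map A (fun x => (phi x).2).
Proof.
move=> reg_phi j; have := reg_phi (rshift _ j); apply: regular_ext => x _.
by rewrite /= /prod_coord row_mxEr.
Qed.

Lemma regular_map_pair X Y F (A : set X) (u : X -> Y) (v : X -> F) :
  regular_map A u -> regular_map A v ->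
  regular_map A (fun x => (u x, v x) : prod_space Y F).
Proof.
move=> reg_u reg_v j; case: (split_ordP j) => j' ->.
  by have := reg_u j'; apply: regular_ext => x _; rewrite /= /prod_coord row_mxEl.
by have := reg_v j'; apply: regular_ext => x _; rewrite /= /prod_coord row_mxEr.
Qed.

Lemma regular_map_row X a b (A : set X) (u : X -> affine k a) (v : X -> affine k b) :
  regular_map A u -> regular_map A v ->
  regular_map A (fun x => row_mx (u x) (v x) : affine k (a + b)).
Proof.
move=> reg_u reg_v j; case: (split_ordP j) => j' ->.
  by have := reg_u j'; apply: regular_ext => x _; rewrite /= row_mxEl.
by have := reg_v j'; apply: regular_ext => x _; rewrite /= row_mxEr.
Qed.

Lemma regular_map_id X (A : set X) : regular_map A id.
Proof. by move=> j; exact: regular_coord. Qed.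

Lemma trivial_fibration_ext X Y F (A : set X) (B : set Y) (C : set F) p q :
  (forall x, A x -> p x = q x) -> trivial_fibration A B C p -> trivial_fibration A B C q.
Proof.
move=> eq_pq [phi [iso_phi phi1]]; exists phi; split=> // x Ax.
by rewrite phi1 // eq_pq.
Qed.

(** The fibre coordinates of the two trivialisations are juxtaposed. *)
Lemma trivial_fibration_comp X Y Z a b (A : set X) (B : set Y) (C : set Z)
    (p : X -> Y) (q : Y -> Z) :
    trivial_fibration A B (setT : set (affine k a)) p ->
    trivial_fibration B C (setT : set (affine k b)) q ->
  trivial_fibration A C (setT : set (affine k (b + a))) (fun x => q (p x)).
Proof.
move=> [phi [[[phiB reg_phi] [psi [[psiA reg_psi] psiK phiK]]] phi1]].
move=> [phi' [[[phiC reg_phi'] [psi' [[psiB reg_psi'] psiK' phiK']]] phi1']].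
have phiB1 x : A x -> B (phi x).1 by move=> /phiB[].
pose u x : Z := (phi' (phi x).1).1.
pose v x : affine k (b + a) := row_mx (phi' (phi x).1).2 (phi x).2.
pose w (y : prod_space Z (affine k (b + a))) : prod_space Z (affine k b) :=
  (y.1, lsubmx (y.2 : 'rV_(b + a))).
pose w' (y : prod_space Z (affine k (b + a))) : prod_space Y (affine k a) :=
  (psi' (w y), rsubmx (y.2 : 'rV_(b + a))).
pose D : set (prod_space Z (affine k (b + a))) := C `*` setT.
have wC y : D y -> (C `*` setT : set (prod_space Z (affine k b))) (w y) by move=> [].
have w'B y : D y -> (B `*` setT : set (prod_space Y (affine k a))) (w' y).
  by move=> Dy; split=> //=; exact/psiB/wC.
have reg_id : regular_map D id by exact: regular_map_id.
have reg_w : regular_map D w.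
  apply: (@regular_map_pair _ Z (affine k b) D (fun y => y.1)
    (fun y => lsubmx (y.2 : 'rV_(b + a)) : affine k b)).
    exact: regular_map_fst.
  move=> j; have := regular_map_snd reg_id (lshift a j); apply: regular_ext => y _.
  by rewrite /= mxE.
have reg_w' : regular_map D w'.
  apply: (@regular_map_pair _ Y (affine k a) D (fun y => psi' (w y))
    (fun y => rsubmx (y.2 : 'rV_(b + a)) : affine k a)).
    exact: (regular_map_comp wC reg_w reg_psi').
  move=> j; have := regular_map_snd reg_id (rshift b j); apply: regular_ext => y _.
  by rewrite /= mxE.
have reg_phi1 : regular_map A (fun x => (phi x).1) by exact: regular_map_fst.
have reg_phi'1 : regular_map A (fun x => phi' (phi x).1).
  exact: (regular_map_comp phiB1 reg_phi1 reg_phi').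
exists (fun x => (u x, v x)); split; last by
  move=> x Ax; rewrite /= /u phi1'; [rewrite phi1 | exact: phiB1].
split; first split.
- by move=> x Ax; split=> //=; have [] := phiC _ (phiB1 x Ax).
- apply: regular_map_pair; first exact: regular_map_fst.
  by apply: regular_map_row; apply: regular_map_snd.
exists (fun y => psi (w' y)); split.
- by split=> [y Dy|]; [exact/psiA/w'B | exact: (regular_map_comp w'B reg_w' reg_psi)].
- move=> x Ax; rewrite -[RHS]psiK //; congr psi; rewrite /w' /w /u /v /= row_mxKl row_mxKr.
  by rewrite -surjective_pairing psiK' -?surjective_pairing //; exact: phiB1.
move=> y Dy; rewrite /u /v phiK; last exact: w'B.
rewrite /w' /= phiK'; last exact: wC.
by rewrite /w /= hsubmxK; case: y {Dy}.
Qed.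

End RegularMaps.

(** * Charts of the truncated stratum and the truncation maps *)

Section Charts.
Variables (k : fieldType) (N m : nat) (IX : set {mpoly k[N]}).
Variables (f : 'I_m -> {mpoly k[N]}) (e : seq nat).
Hypotheses (hIX : IX = ideal_gen f) (le_mN : (m <= N)%N).
Hypotheses (sorted_e : sorted leq e) (size_e : size e = m).
Local Notation R := {fps k}.
Local Notation em := (last 0%N e).
Local Notation L l := (arc_stratum_image IX f l e).
Local Notation has_type A := (mx_equiv A (smith_mx k m N e)).
Local Notation const_col := (map_mx (@fps_const k)).

Variable g : {ffun 'I_m -> 'I_N}.
Hypothesis inj_g : injective g.

(** A constant vector is the sum of its part supported in the columns [g] and of
    its part supported in the other columns, enumerated by h. *)
Lemma complement_columns : exists h : 'I_(N - m) -> 'I_N,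
  [/\ injective h, forall i j, (h j == g i) = false &
  forall x : 'cV[k]_N, const_col x =
    colsub h 1%:M *m const_col (rowsub h x) + colsub g 1%:M *m const_col (rowsub g x)].
Proof.
pose G := [set g i | i in 'I_m]%SET.
have cardG : #|~: G| = (N - m)%N by rewrite cardsCs finset.setCK card_ord card_imset ?card_ord.
pose h (j : 'I_(N - m)) := enum_val (cast_ord (esym cardG) j).
have inj_h : injective h by move=> i j /enum_val_inj/cast_ord_inj.
exists h; split=> // [i j|x].
  apply/eqP => hg; have := enum_valP (cast_ord (esym cardG) j).
  by rewrite inE -/(h j) hg imset_f.
apply/colP => i; rewrite !mxE.
have [Gi|nGi] := boolP (i \in G).
  have [i' _ iE] := imsetP Gi; rewrite big1 ?add0r => [|j _]; last first.
    rewrite !mxE; case: eqP => [ij|]; last by rewrite mul0r.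
    by have := enum_valP (cast_ord (esym cardG) j); rewrite inE -/(h j) -ij Gi.
  rewrite (bigD1 i') //= big1 ?addr0 => [|j /negPf ne_j]; rewrite !mxE iE.
    by rewrite eqxx mul1r.
  by rewrite (inj_eq inj_g) eq_sym ne_j mul0r.
have Gi : i \in ~: G by rewrite inE.
pose j := cast_ord cardG (enum_rank_in Gi i).
have iE : i = h j by rewrite /h /j cast_ordK enum_rankK_in.
rewrite [X in _ + X]big1 ?addr0 => [|i' _]; last first.
  rewrite !mxE; case: eqP => [ii'|]; last by rewrite mul0r.
  by case/imsetP: nGi; exists i'.
rewrite (bigD1 j) //= big1 ?addr0 => [|j' /negPf ne_j]; rewrite !mxE iE.
  by rewrite eqxx mul1r.
by rewrite (inj_eq inj_h) eq_sym ne_j mul0r.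
Qed.

(** The open part of the truncated stratum where the columns selected by [g] span
    the column space of the Jacobian. *)
Definition chart l : set (jet_space k N l) :=
  L l `&` [set theta | minor_coef e g (jacobian f (jet_lift theta)) != 0].

Arguments chart l theta : clear implicits.

Lemma minor_coef_trunc l a a' : (em <= l)%N -> has_type (jacobian f a) ->
    arc_trunc l a = arc_trunc l a' ->
  minor_coef e g (jacobian f a') = minor_coef e g (jacobian f a).
Proof.
move=> le_el type_a /arc_trunc_eq[x ->]; have [M ->] := jacobian_taylor f a l.+1 x.
exact: (minor_coef_perturb sorted_e size_e le_mN).
Qed.

Lemma chartP l a : (em <= l)%N -> chart l (arc_trunc l a) <->
  [/\ has_type (jacobian f a), liftable f l.+1 a & minor_coef e g (jacobian f a) != 0].
Proof.
move=> le_el; have lift_a : arc_trunc l a = arc_trunc l (jet_lift (arc_trunc l a)).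
  by rewrite jet_liftK.
have LP := arc_stratum_imageP hIX le_mN sorted_e size_e a le_el.
have coef_lift type_a := minor_coef_trunc le_el type_a lift_a.
split=> [[La g0]|[type_a lift g0]].
  have [type_a lift] := LP.1 La; split; [exact: type_a | exact: lift |].
  by rewrite -(coef_lift type_a).
split; first exact: LP.2 (conj type_a lift).
by move: g0; rewrite -(coef_lift type_a).
Qed.

(** The chart of order n is pulled back from order l, since the leading
    coefficient of a minor of least order depends only on the jet of order e_m. *)
Lemma chart_trunc n l theta : (em <= l)%N -> (l <= n)%N ->
  chart n theta <-> L n theta /\ chart l (jet_trunc l theta).
Proof.
move=> le_el le_ln; have le_en := leq_trans le_el le_ln.
set a := jet_lift theta; have <- : arc_trunc n a = theta by exact: jet_liftK.
rewrite (jet_trunc_arc a le_ln).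
have LP := arc_stratum_imageP hIX le_mN sorted_e size_e a le_en.
have LP' := arc_stratum_imageP hIX le_mN sorted_e size_e a le_el.
split=> [/(chartP a le_en)[type_a lift_a g0]|[La /(chartP a le_el)[type_a _ g0]]].
  have La := LP.2 (conj type_a lift_a); split; first exact: La.
  have := stratum_image_trunc le_ln La; rewrite (jet_trunc_arc a le_ln) => La'.
  by apply/(chartP a le_el); split; [exact: type_a | exact: (LP'.1 La').2 | exact: g0].
by apply/(chartP a le_en); split; [exact: type_a | exact: (LP.1 La).2 | exact: g0].
Qed.

Section Step.
Variable l : nat.
Hypothesis le_el : (em <= l)%N.

(** The coefficient whose vanishing is the condition of [liftable_step]. *)
Definition obstruction a (x : 'cV[R]_N) (i : 'I_m) : k :=
  (\adj (colsub g (jacobian f a)) *m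
     (equations f a + fps_Xn k l.+1 *: (jacobian f a *m x))) i 0 (sumn e + l.+1)%N.

(** adj(J_g) J_g is det(J_g) times the identity: the coordinates in the columns
    [g] enter the obstruction diagonally. *)
Lemma obstruction_columns a x (z : 'cV[k]_m) i : has_type (jacobian f a) ->
  obstruction a (x + colsub g 1%:M *m const_col z) i =
  obstruction a x i + minor_coef e g (jacobian f a) * z i 0.
Proof.
move=> type_a; have [u [<- det_a]] := minor_coef_det sorted_e size_e le_mN g type_a.
have := adj_columns_add g (jacobian f a) (fps_Xn k l.+1) (equations f a) x (const_col z) i.
rewrite det_a => /(congr1 (fun y : R => y (sumn e + l.+1)%N)) split_sum.
apply: etrans split_sum _; rewrite [LHS]coef_fpsD; congr (_ + _).
rewrite mulrCA -!mulrA mulrA -fps_XnD addnC coef_fpsXnM ltnn subnn mxE.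
by rewrite -[LHS]/(fps_at0 _) rmorphM.
Qed.

Variable h : 'I_(N - m) -> 'I_N.

Definition fiber_coord (theta : jet_space k N l.+1) : affine k (N - m) :=
  \row_j jet_lift theta (h j) l.+1.

(** The solution of obstruction = 0 in the coordinates of the columns [g], for
    given coordinates y in the columns [h]. *)
Definition dependent_coord a (y : 'cV[k]_(N - m)) : 'cV[k]_m :=
  \col_i - (obstruction a (colsub h 1%:M *m const_col y) i / minor_coef e g (jacobian f a)).

Definition lift_direction a (y : 'cV[k]_(N - m)) : 'cV[R]_N :=
  colsub h 1%:M *m const_col y + colsub g 1%:M *m const_col (dependent_coord a y).

Definition lift_jet (p : prod_space (jet_space k N l) (affine k (N - m))) :
    jet_space k N l.+1 :=
  let a := jet_lift p.1 in
  arc_trunc l.+1 (arc_add a l.+1 (lift_direction a (p.2 : 'rV_(N - m))^T)).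

Lemma obstruction_lift a y i : has_type (jacobian f a) ->
  minor_coef e g (jacobian f a) != 0 -> obstruction a (lift_direction a y) i = 0.
Proof.
move=> type_a g0; rewrite /lift_direction (obstruction_columns _ _ _ type_a).
by rewrite [(dependent_coord a y) i 0]mxE mulrN mulrC divfK ?subrr.
Qed.

Lemma chart_lift a y : chart l (arc_trunc l a) ->
  chart l.+1 (arc_trunc l.+1 (arc_add a l.+1 (lift_direction a y))).
Proof.
move=> /(chartP a le_el)[type_a lift_a g0]; apply/chartP; first exact: leqW.
split.
- exact: (has_type_arc_add sorted_e size_e le_mN _ _ type_a).
- apply/(liftable_step sorted_e size_e le_mN _ _ type_a g0 lift_a) => // i.
  exact: (obstruction_lift y i type_a g0).
rewrite (minor_coef_trunc le_el type_a) //.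
by apply/arc_trunc_eq; exists (lift_direction a y).
Qed.

Hypothesis complement_h : forall x : 'cV[k]_N, const_col x =
  colsub h 1%:M *m const_col (rowsub h x) + colsub g 1%:M *m const_col (rowsub g x).

(** The minor is invertible, so the vanishing of the obstruction leaves one choice
    for the coordinates in the columns [g]. *)
Lemma lift_direction_unique a (x : 'cV[k]_N) :
    chart l (arc_trunc l a) -> chart l.+1 (arc_trunc l.+1 (arc_add a l.+1 (const_col x))) ->
  const_col x = lift_direction a (rowsub h x).
Proof.
move=> /(chartP a le_el)[type_a lift_a g0] /(chartP _ (leqW le_el))[_ lift_ax _].
rewrite complement_h /lift_direction; congr (_ + _ *m map_mx _ _).
apply/colP => i; rewrite [RHS]mxE.
have obs0 : obstruction a (const_col x) i = 0.
  have lt_el : (em < l.+1)%N by [].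
  exact: ((liftable_step sorted_e size_e le_mN _ lt_el type_a g0 lift_a).1 lift_ax i).
rewrite complement_h (obstruction_columns _ _ _ type_a) in obs0.
apply: (mulfI g0); rewrite mulrN [X in - X]mulrC divfK //.
by apply/eqP; rewrite -addr_eq0 addrC obs0.
Qed.

End Step.

(** The inverse of the trivialisation: the coordinates in the complementary
    columns are free, and those in the columns selected by [g] are determined by
    the vanishing of the obstruction. *)
Theorem chart_fibration l : (em <= l)%N ->
  trivial_fibration (chart l.+1) (chart l) (setT : set (affine k (N - m))) (jet_trunc l).
Proof.
move=> le_el; have [h [inj_h h_neq_g complement_h]] := complement_columns.
pose XF := prod_space (jet_space k N l) (affine k (N - m)).
pose phi (theta : jet_space k N l.+1) : XF := (jet_trunc l theta, fiber_coord h theta).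
have chart_down theta : chart l.+1 theta -> chart l (jet_trunc l theta).
  by move=> /(chart_trunc _ le_el (leqnSn l))[].
have coef_lift_ge (theta : jet_space k N l) j : jet_lift theta j l.+1 = 0.
  by rewrite ffunE /= nth_default // size_tpoly_poly.
have coef_dir a y j : (lift_direction l h a y j 0) 0%N =
    \sum_i (j == h i)%:R * y i 0 + \sum_i (j == g i)%:R * dependent_coord l h a y i 0.
  rewrite /lift_direction mxE coef_fpsD; congr (_ + _).
    rewrite mxE coef_fps_sum; apply: eq_bigr => i _.
    rewrite !mxE mulrC coef_fpsCM mulrC; congr (_ * _).
    by case: (j == h i).
  rewrite mxE coef_fps_sum; apply: eq_bigr => i _.
  rewrite !mxE mulrC coef_fpsCM mulrC; congr (_ * _).
  by case: (j == g i).
pose D : set XF := chart l `*` setT.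
have pol_fst c : polynomial_fun (fun p : XF => acoord p.1 0 c).
  have [q qE] := @polynomial_fun_coord k XF (lshift _ c).
  by exists q => p; rewrite -qE /= /prod_coord row_mxEl.
have pol_snd j : polynomial_fun (fun p : XF => (p.2 : 'rV_(N - m)) 0 j).
  have [q qE] := @polynomial_fun_coord k XF (rshift _ j).
  by exists q => p; rewrite -qE /= /prod_coord row_mxEr.
have pol_lift := polynomial_jet_lift pol_fst.
have pol_const_snd : polynomial_mx (fun p : XF => const_col (p.2 : 'rV_(N - m))^T).
  move=> j z n; have [|q qE] := @polynomial_funM k XF (fun p => (p.2 : 'rV_(N - m)) 0 j)
    (fun=> (n == 0%N)%:R) (pol_snd j); first exact: polynomial_fun_cst.
  exists q => p; rewrite -qE !mxE (ord1 z).
  by case: n {qE} => [|n] /=; rewrite ?mulr1 ?mulr0.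
have pol_cst m' n' (M : 'M[R]_(m', n')) : polynomial_mx (fun _ : XF => M).
  by move=> i j; exact: polynomial_series_cst.
have pol_J := polynomial_jacobian f pol_lift.
have reg_dep i : regular_function D
    (fun p : XF => dependent_coord l h (jet_lift p.1) (p.2 : 'rV_(N - m))^T i 0).
  apply: (@regular_ext _ _ _ (fun p : XF =>
    -1 * (obstruction l (jet_lift p.1) (colsub h 1%:M *m const_col (p.2 : 'rV_(N - m))^T) i
      * (minor_coef e g (jacobian f (jet_lift p.1)))^-1))).
    by move=> p _; rewrite mxE mulN1r.
  apply: regularM; first exact: regular_cst.
  apply: regularM.
    apply: regular_polynomial; apply: polynomial_mxM.
      by apply: polynomial_adj; apply: polynomial_mx_sub.
    apply: polynomial_mxD; first exact: polynomial_equations.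
    apply: polynomial_mxZ; apply: polynomial_mxM => //.
    exact: polynomial_mxM.
  apply: regularV; first by move=> p [[_ g0] _]; exact/eqP.
  by apply: regular_polynomial; exact: polynomial_minor_coef.
exists phi; split; last by [].
split; first split.
- by move=> theta /chart_down.
- apply: regular_map_pair => j; last first.
    apply: regular_polynomial.
    have [q qE] := polynomial_jet_lift (@polynomial_fun_coord k (jet_space k N l.+1)) (h j) l.+1.
    by exists q => theta; rewrite -qE /= mxE.
  case/mxvec_indexP: j => i s; apply: regular_polynomial.
  have [q qE] := polynomial_jet_lift (@polynomial_fun_coord k (jet_space k N l.+1)) i s.
  by exists q => theta; rewrite -qE jet_coordE coef_jet_trunc // -ltnS.
exists (lift_jet h); split.
- split=> [p [Dp _]|j].
    by apply: (chart_lift le_el); rewrite jet_liftK.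
  case/mxvec_indexP: j => i s.
  apply: (@regular_ext _ _ _ (fun p : XF => jet_lift p.1 i s + (s == l.+1 :> nat)%:R *
    (\sum_j (i == h j)%:R * (p.2 : 'rV_(N - m)) 0 j +
     \sum_j (i == g j)%:R * dependent_coord l h (jet_lift p.1) (p.2 : 'rV_(N - m))^T j 0))).
    move=> p _; rewrite jet_coordE coef_arc_trunc; last by rewrite -ltnS.
    rewrite coef_arc_add; congr (_ + _).
    case: ltnP => [lt_s|le_s]; first by rewrite ltn_eqF ?mul0r.
    have -> : s = l.+1 :> nat by apply/eqP; rewrite eqn_leq le_s -ltnS ltn_ord.
    rewrite eqxx mul1r subnn coef_dir; congr (_ + _).
    by apply: eq_bigr => j _; rewrite mxE.
  apply: regularD; first by apply: regular_polynomial; exact: pol_lift.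
  apply: regularM; first exact: regular_cst.
  apply: regularD; apply: regular_sum => j; apply: regularM; try exact: regular_cst.
    exact: regular_polynomial.
  exact: reg_dep.
- move=> theta chart_theta; rewrite /lift_jet /phi /=.
  set a := jet_lift (jet_trunc l theta).
  pose x : 'cV[k]_N := \col_j jet_lift theta j l.+1.
  have thetaE : theta = arc_trunc l.+1 (arc_add a l.+1 (const_col x)).
    rewrite -[LHS]jet_liftK; apply: eq_arc_trunc => j n lt_n.
    rewrite coef_arc_add !mxE.
    have [lt_nl|le_ln] := ltnP n l.+1; first by rewrite addr0 [RHS]coef_jet_lift coef_jet_trunc.
    have -> : n = l.+1 by apply/eqP; rewrite eqn_leq le_ln -ltnS lt_n.
    by rewrite subnn coef_lift_ge add0r.
  have -> : (fiber_coord h theta)^T = rowsub h x by apply/colP => j; rewrite !mxE.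
  have chart_a : chart l (arc_trunc l a) by rewrite jet_liftK; exact: chart_down.
  have chart_ax : chart l.+1 (arc_trunc l.+1 (arc_add a l.+1 (const_col x))).
    by rewrite -thetaE.
  rewrite -(lift_direction_unique le_el complement_h chart_a chart_ax).
  exact: esym thetaE.
move=> [theta y] [/= chart_theta _]; rewrite /phi /lift_jet /=; set a := jet_lift theta.
congr pair.
  rewrite jet_trunc_arc //; rewrite -[RHS]jet_liftK -/a.
  by apply/esym/arc_trunc_eq; eexists.
apply/rowP => j; rewrite mxE coef_jet_lift coef_arc_trunc //.
rewrite coef_arc_add ltnn subnn coef_dir coef_lift_ge add0r.
rewrite [X in _ + X]big1 ?addr0 => [|i _]; last by rewrite h_neq_g mul0r.
rewrite (bigD1 j) //= big1 ?addr0 => [|i /negPf ne_ij].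
  by rewrite eqxx mul1r mxE.
by rewrite (inj_eq inj_h) eq_sym ne_ij mul0r.
Qed.

Lemma chart_fibration_iter l d n : (em <= l)%N -> n = (l + d.+1)%N ->
  trivial_fibration (chart n) (chart l) (setT : set (affine k ((N - m) * d.+1))) (jet_trunc l).
Proof.
move=> le_el; elim: d n => [|d IHd] n.
  by rewrite addn1 muln1 => ->; exact: chart_fibration.
rewrite addnS => ->; rewrite mulnSr.
have le_eld : (em <= l + d.+1)%N by apply: leq_trans le_el _; exact: leq_addr.
have := trivial_fibration_comp (chart_fibration le_eld) (IHd _ erefl).
apply: trivial_fibration_ext => theta _.
by rewrite jet_trunc_trunc ?leq_addr.
Qed.

Lemma open_chart l : open_in (L l) (chart l).
Proof.
exists [set theta | minor_coef e g (jacobian f (jet_lift theta)) != 0] => //.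
rewrite /zariski_open.
have -> : ~` [set theta | minor_coef e g (jacobian f (jet_lift theta)) != 0] =
    [set theta : jet_space k N l | minor_coef e g (jacobian f (jet_lift theta)) = 0].
  apply/predeqP => theta; split=> /= [/negP|/eqP]; first by rewrite negbK => /eqP.
  by move=> g0; apply/negP; rewrite negbK.
apply: zariski_closed_zero; apply: polynomial_minor_coef.
exact: polynomial_jet_lift (@polynomial_fun_coord k (jet_space k N l)).
Qed.

Lemma chart_preimage n l : (em <= l)%N -> (l <= n)%N ->
  chart n = L n `&` [set theta | chart l (jet_trunc l theta)].
Proof. by move=> le_el le_ln; apply/predeqP => theta; exact: chart_trunc. Qed.

End Charts.

Arguments chart {k N m} IX f e g l theta.

Section Cover.
Variables (k : fieldType) (N m : nat) (IX : set {mpoly k[N]}).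
Variables (f : 'I_m -> {mpoly k[N]}) (e : seq nat).
Hypotheses (hIX : IX = ideal_gen f) (le_mN : (m <= N)%N).
Hypotheses (sorted_e : sorted leq e) (size_e : size e = m).

Lemma chart_cover l theta : (last 0%N e <= l)%N -> arc_stratum_image IX f l e theta ->
  exists g : {ffun 'I_m -> 'I_N}, injective g /\ chart IX f e g l theta.
Proof.
move=> le_el Ltheta.
have [type_theta _] : mx_equiv (jacobian f (jet_lift theta)) (smith_mx k m N e) /\
    liftable f l.+1 (jet_lift theta).
  by apply/(arc_stratum_imageP hIX le_mN sorted_e size_e _ le_el); rewrite jet_liftK.
have [g g0] := minor_coef_exists sorted_e size_e le_mN type_theta.
by exists g; split; [exact: minor_coef_inj g0 | split].
Qed.

End Cover.

Local Close Scope ring_scope.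

Theorem proposition1 (k : closedFieldType) (N m : nat)
    (IX : set {mpoly k[N]}) (f : 'I_m -> {mpoly k[N]})
    (hIX : IX = ideal_gen f) (hmN : (m <= N)%N)
    (e : m.-tuple nat) (he : sorted leq e) :
  let em := last 0%N e in (* e_m, with e_0 = 0 when m = 0 *)
  let L (l : nat) : set (jet_space k N l) := arc_stratum_image IX f l e in
  [/\ (* (a) *)
      forall l i : nat, (em <= l)%N -> (em <= i)%N ->
        jet_trunc l @` jet_stratum IX f (l + i) e = L l /\ locally_closed (L l),
      (* (b) *)
      forall gamma : jet_space k N em, L em gamma ->
        exists U : set (jet_space k N em),
          [/\ open_in (L em) U, U gamma &
              let U_ (i : nat) : set (jet_space k N i) :=
                L i `&` [set theta | U (jet_trunc em theta)] in
              forall l : nat, (em <= l)%N ->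
                trivial_fibration (U_ l.+1) (U_ l)
                  (setT : set (affine k (N - m))) (jet_trunc l)]
    & (* (c) *)
      forall n l : nat, (em <= l)%N -> (l < n)%N ->
        locally_trivial_fibration (L n) (L l)
          (setT : set (affine k ((N - m) * (n - l)))) (jet_trunc l)].
Proof.
move=> em L; have size_e := size_tuple e; split.
- move=> l i le_el le_ei; split.
    exact: (jet_stratum_image hIX hmN he size_e le_el le_ei).
  exact: (locally_closed_stratum_image hIX hmN he size_e le_el).
- move=> gamma Lgamma.
  have [g [inj_g Ug]] := chart_cover hIX hmN he size_e (leqnn _) Lgamma.
  exists (chart IX f e g em); split; [exact: open_chart | exact: Ug |].
  move=> U_ l le_el.
  have U_E i : (em <= i)%N -> U_ i = chart IX f e g i.
    move=> le_ei.
    by rewrite (chart_preimage hIX hmN he size_e g (leqnn _) le_ei).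
  rewrite (U_E _ le_el) (U_E _ (leqW le_el)).
  exact: (chart_fibration hIX hmN he size_e inj_g le_el).
- move=> n l le_el lt_ln; split=> [theta|b Lb].
    exact: stratum_image_trunc (ltnW lt_ln).
  have [g [inj_g Vb]] := chart_cover hIX hmN he size_e le_el Lb.
  exists (chart IX f e g l); split; [exact: open_chart | exact: Vb |].
  have -> : (n - l = (n - l.+1).+1)%N by rewrite subnSK.
  have -> : L n `&` (jet_trunc l : jet_space k N n -> _) @^-1` chart IX f e g l =
      chart IX f e g n.
    by rewrite (chart_preimage hIX hmN he size_e g le_el (ltnW lt_ln)).
  apply: (chart_fibration_iter hIX hmN he size_e inj_g le_el).
  by rewrite -subSn ?subSS ?subnKC // ltnW.
Qed.
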